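(* Let $k$ be a field, let $\Gamma$ be a rooted tree with vertex set $\{x_1,\ldots,x_n\}$, directed away from its root, let $R=k[x_1,\ldots,x_n]$, and let $t\ge 2$ be an integer. If $I_t(\Gamma)\subseteq R$ is the path ideal of $\Gamma$ of length $t$, then $R/I_t(\Gamma)$ is sequentially Cohen-Macaulay.
   Context: A tree is a finite simple graph in which any two distinct vertices are joined by a unique path. A tree $\Gamma$ is viewed as a directed graph by choosing any vertex to be the root and directing every edge away from the root; $(u,v)$ denotes an edge directed from $u$ to $v$. The vertices $x_1,\ldots,x_n$ of $\Gamma$ are identified with the variables of $R=k[x_1,\ldots,x_n]$. A path of length $t$ in a directed graph is a sequence of $t$ vertices $x_{i_1},\ldots,x_{i_t}$ such that $(x_{i_j},x_{i_{j+1}})$ is a directed edge for $j=1,\ldots,t-1$ (so length counts vertices). The path ideal of length $t$ is the monomial ideal $$I_t(\Gamma)=\left(\{x_{i_1}\cdots x_{i_t} : x_{i_1},\ldots,x_{i_t}\text{ is a path of length }t\text{ in }\Gamma\}\right)\subseteq R.$$ A graded $R$-module $M$ is sequentially Cohen-Macaulay (over $k$) if there is a finite filtration of graded $R$-modules $0=M_0\subset M_1\subset\cdots\subset M_r=M$ such that each $M_i/M_{i-1}$ ($1\le i\le r$) is Cohen-Macaulay and the Krull dimensions are increasing: $\dim(M_1/M_0)<\dim(M_2/M_1)<\cdots<\dim(M_r/M_{r-1})$. *)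

(* Defs.v *)
From HB Require Import structures.
From mathcomp Require Import all_boot all_order all_algebra.
From mathcomp Require Import generic_quotient ring_quotient.
From mathcomp Require Import boolp mpoly.

Set Implicit Arguments.
Unset Strict Implicit.
Unset Printing Implicit Defensive.

Import GRing.Theory.
Local Open Scope ring_scope.
Local Open Scope quotient_scope.

Section Modules.
Variable A : comNzRingType.

Section SubmoduleOf.
Variables (V : lmodType A) (N : submodClosed V).

Definition submodule_of := {x : V | x \in N}.
HB.instance Definition _ := SubChoice.on submodule_of.
HB.instance Definition _ :=
  [SubChoice_isSubLmodule of submodule_of by <:].

Definition submodule_val (x : submodule_of) : V := val x.

Lemma submodule_val_is_linear : linear submodule_val.
Proof. by []. Qed.

HB.instance Definition _ :=
  GRing.isLinear.Build A submodule_of V _ submodule_val submodule_val_is_linear.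

End SubmoduleOf.

Section QuotientModule.
Variables (V : lmodType A) (N : submodClosed V).

(* [submodClosed] does not inherit from [zmodClosed], which [{quot _}] needs *)
Definition submod_zmod : {pred V} := N.

Lemma submod_zmod_closed : zmod_closed submod_zmod.
Proof. exact/GRing.submod_closedB/submodClosedP. Qed.

HB.instance Definition _ :=
  GRing.isZmodClosed.Build V submod_zmod submod_zmod_closed.

Definition quotmod := Quotient.quot submod_zmod.
HB.instance Definition _ := GRing.Zmodule.on quotmod.

Definition quotmod_pi (x : V) : quotmod := \pi_quotmod x.

Lemma quotmod_pi_eq x y : (quotmod_pi x = quotmod_pi y) <-> (x - y \in N).
Proof.
rewrite /quotmod_pi; split=> [/eqP|H]; last apply/eqP.
  by rewrite -Quotient.idealrBE.
by rewrite -Quotient.idealrBE.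
Qed.

Lemma quotmod_pi_surj (y : quotmod) : exists x, quotmod_pi x = y.
Proof. by exists (repr y); rewrite /quotmod_pi reprK. Qed.

Lemma quotmod_piD x y : quotmod_pi (x + y) = quotmod_pi x + quotmod_pi y.
Proof. exact: raddfD. Qed.

Definition quotmod_scale (a : A) (y : quotmod) : quotmod :=
  quotmod_pi (a *: repr y).

Lemma quotmod_scale_pi a x :
  quotmod_scale a (quotmod_pi x) = quotmod_pi (a *: x).
Proof.
apply/quotmod_pi_eq; rewrite -scalerBr rpredZ //.
by apply/quotmod_pi_eq; rewrite /quotmod_pi reprK.
Qed.

Lemma quotmod_scaleA a b y :
  quotmod_scale a (quotmod_scale b y) = quotmod_scale (a * b) y.
Proof.
by have [x <-] := quotmod_pi_surj y; rewrite !quotmod_scale_pi scalerA.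
Qed.

Lemma quotmod_scale1 : left_id 1 quotmod_scale.
Proof.
by move=> y; have [x <-] := quotmod_pi_surj y; rewrite quotmod_scale_pi scale1r.
Qed.

Lemma quotmod_scaleDr : right_distributive quotmod_scale +%R.
Proof.
move=> a y z; have [x <-] := quotmod_pi_surj y.
have [x' <-] := quotmod_pi_surj z.
by rewrite -quotmod_piD !quotmod_scale_pi scalerDr quotmod_piD.
Qed.

Lemma quotmod_scaleDl y : {morph quotmod_scale^~ y : a b / a + b}.
Proof.
move=> a b; have [x <-] := quotmod_pi_surj y.
by rewrite !quotmod_scale_pi scalerDl quotmod_piD.
Qed.

HB.instance Definition _ := GRing.Zmodule_isLmodule.Build A quotmod
  quotmod_scaleA quotmod_scale1 quotmod_scaleDr quotmod_scaleDl.

Lemma quotmod_pi_is_linear : linear quotmod_pi.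
Proof. by move=> a x y; rewrite quotmod_piD -quotmod_scale_pi. Qed.

HB.instance Definition _ :=
  GRing.isLinear.Build A V quotmod _ quotmod_pi quotmod_pi_is_linear.

Lemma quotmod_pi_eq0 x : (quotmod_pi x = 0) <-> (x \in N).
Proof. by rewrite -[x in x \in N]subr0 -quotmod_pi_eq (raddf0 quotmod_pi). Qed.

End QuotientModule.

Section Subquotient.
Variables (V : lmodType A) (L N : submodClosed V).

Definition trace_in : {pred submodule_of N} := [pred x | submodule_val x \in L].

Lemma trace_in_closed : submod_closed trace_in.
Proof.
split=> [|a x y]; rewrite !inE ?raddf0 ?rpred0 // => xL yL.
by rewrite linearP rpredD ?rpredZ.
Qed.

HB.instance Definition _ :=
  GRing.isSubmodClosed.Build A (submodule_of N) trace_in trace_in_closed.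

(* N / (L :&: N), which is N / L when L is included in N *)
Definition subquotient : lmodType A := quotmod trace_in.

End Subquotient.

(* Krull dimension of V = Krull dimension of A / Ann V, measured by the length d
   of strict chains P_0 < ... < P_d of primes containing Ann V; the zero module
   has no Krull dimension, hence is not Cohen-Macaulay below *)
Definition annihilates (V : lmodType A) (a : A) : Prop := forall x : V, a *: x = 0.

Definition prime_chain (V : lmodType A) (d : nat) : Prop :=
  exists P : 'I_d.+1 -> prime_idealr A,
    (forall i a, annihilates V a -> a \in P i) /\
    (forall i j : 'I_d.+1, (i < j)%N ->
       {subset P i <= P j} /\ exists2 a, a \in P j & a \notin P i).

Definition has_krull_dim (V : lmodType A) (d : nat) : Prop :=
  prime_chain V d /\ forall e, prime_chain V e -> (e <= d)%N.

(* x lies in (a_1, ..., a_m) V, where s = [:: a_1; ...; a_m] *)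
Definition in_seq_mul (V : lmodType A) (s : seq A) (x : V) : Prop :=
  exists y : nat -> V, x = \sum_(i < size s) s`_i *: y i.

Definition regular_seq (V : lmodType A) (s : seq A) : Prop :=
  (forall i, (i < size s)%N -> forall x : V,
     in_seq_mul (take i s) (s`_i *: x) -> in_seq_mul (take i s) x) /\
  (exists x : V, ~ in_seq_mul s x).

(* depth with respect to an ideal J: the maximal length of a V-regular sequence
   in J *)
Definition has_depth (J : {pred A}) (V : lmodType A) (d : nat) : Prop :=
  (exists s, [/\ size s = d, {subset s <= J} & regular_seq V s]) /\
  (forall s, {subset s <= J} -> regular_seq V s -> (size s <= d)%N).

Definition ideal_gen (S : A -> Prop) : {pred A^o} :=
  [pred p | `[< exists s : seq (A * A),
     (forall g, g \in s -> S g.2) /\ p = \sum_(g <- s) g.1 * g.2 >]].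

Lemma ideal_gen_closed S : submod_closed (ideal_gen S).
Proof.
split=> [|a p q]; first by apply/asboolP; exists [::]; rewrite big_nil.
move=> /asboolP[s [Ss ->]] /asboolP[s' [Ss' ->]]; apply/asboolP.
exists ([seq (a * g.1, g.2) | g <- s] ++ s'); split=> [g|].
  by rewrite mem_cat => /orP[/mapP[h /Ss Sh ->]|/Ss'].
rewrite big_cat big_map /=; congr (_ + _).
rewrite scaler_sumr; apply: eq_bigr => g _; exact: mulrA.
Qed.

HB.instance Definition _ S :=
  GRing.isSubmodClosed.Build A A^o (ideal_gen S) (ideal_gen_closed S).

End Modules.

Section Graded.
Variables (k : fieldType) (n : nat).
Local Notation R := {mpoly k[n]}.

(* (x_1, ..., x_n) *)
Definition maximal_ideal : {pred R} := ideal_gen (fun p : R => exists i, p = 'X_i).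

Definition Cohen_Macaulay (V : lmodType R) : Prop :=
  exists d, has_krull_dim V d /\ has_depth maximal_ideal V d.

Record gradedModule := GradedModule {
  gm_sort :> lmodType R;
  gm_comp : int -> zmodClosed gm_sort;
  gm_scale : forall (e : nat) (d : int) (p : R) (x : gm_sort),
    p \is e.-homog -> x \in gm_comp d -> p *: x \in gm_comp (e%:Z + d);
  gm_span : forall x : gm_sort, exists (s : seq int) (f : int -> gm_sort),
    [/\ uniq s, forall d, f d \in gm_comp d & x = \sum_(d <- s) f d];
  gm_direct : forall (s : seq int) (f : int -> gm_sort),
    uniq s -> (forall d, f d \in gm_comp d) -> \sum_(d <- s) f d = 0 ->
    forall d, d \in s -> f d = 0
}.

Definition graded_sub (M : gradedModule) (N : submodClosed M) : Prop :=
  forall x, x \in N -> exists (s : seq int) (f : int -> M),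
    [/\ uniq s, forall d, f d \in gm_comp M d, forall d, f d \in N &
        x = \sum_(d <- s) f d].

Definition sequentially_CM (M : gradedModule) : Prop :=
  exists (r : nat) (F : nat -> submodClosed M) (d : nat -> nat),
    [/\ F 0%N =i pred1 0 /\ F r =i predT,
        forall i, (i <= r)%N -> graded_sub (F i),
        forall i, (i < r)%N -> {subset F i <= F i.+1} /\
          exists2 x, x \in F i.+1 & x \notin F i,
        forall i, (i < r)%N -> Cohen_Macaulay (subquotient (F i) (F i.+1)) /\
          has_krull_dim (subquotient (F i) (F i.+1)) (d i) &
        forall i, (i.+1 < r)%N -> (d i < d i.+1)%N].

Section QuotientGraded.
Variables (M : gradedModule) (N : submodClosed M).
Hypothesis hN : graded_sub N.

Definition quot_comp (d : int) : {pred quotmod N} :=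
  [pred y | `[< exists2 x, x \in gm_comp M d & y = quotmod_pi N x >]].

Lemma quot_comp_closed d : zmod_closed (quot_comp d).
Proof.
split=> [|y z]; first by apply/asboolP; exists 0; rewrite ?rpred0 ?raddf0.
move=> /asboolP[x hx ->] /asboolP[x' hx' ->]; apply/asboolP.
by exists (x - x'); rewrite ?rpredB ?raddfB.
Qed.

HB.instance Definition _ d :=
  GRing.isZmodClosed.Build (quotmod N) (quot_comp d) (quot_comp_closed d).

Lemma quot_comp_scale (e : nat) (d : int) (p : R) (y : quotmod N) :
  p \is e.-homog -> y \in quot_comp d -> p *: y \in quot_comp (e%:Z + d).
Proof.
move=> hp /asboolP[x hx ->]; apply/asboolP; exists (p *: x).
  exact: gm_scale.
by rewrite linearZ.
Qed.

Lemma quot_comp_span (y : quotmod N) :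
  exists (s : seq int) (f : int -> quotmod N),
    [/\ uniq s, forall d, f d \in quot_comp d & y = \sum_(d <- s) f d].
Proof.
have [x <-] := quotmod_pi_surj y; have [s [f [us hf ->]]] := gm_span x.
exists s, (fun d => quotmod_pi N (f d)); split=> // [d|]; last exact: raddf_sum.
by apply/asboolP; exists (f d).
Qed.

Lemma quot_comp_direct (s : seq int) (f : int -> quotmod N) :
  uniq s -> (forall d, f d \in quot_comp d) -> \sum_(d <- s) f d = 0 ->
  forall d, d \in s -> f d = 0.
Proof.
move=> us hf; have /choice[g hg] : forall d, exists x : M,
  x \in gm_comp M d /\ f d = quotmod_pi N x.
  by move=> d; have /asboolP[x] := hf d; exists x.
under eq_bigr => d _ do rewrite (hg d).2.
rewrite -raddf_sum => /quotmod_pi_eq0/hN[s' [h [us' h1 h2 E]]] d ds.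
pose u := undup (s ++ s').
pose G c := (if c \in s then g c else 0) - (if c \in s' then h c else 0).
have ext (q : int -> M) (w : seq int) : uniq w -> {subset w <= s ++ s'} ->
    \sum_(c <- w) q c = \sum_(c <- u) (if c \in w then q c else 0).
  move=> uw sw; rewrite -big_mkcond -[in RHS]big_filter.
  apply: perm_big; apply: uniq_perm => //.
    by rewrite filter_uniq ?undup_uniq.
  move=> c; rewrite mem_filter mem_undup; case cw: (c \in w) => //=.
  by rewrite sw.
have G0 : \sum_(c <- u) G c = 0.
  rewrite sumrB -ext // => [|c cs]; last by rewrite mem_cat cs.
  rewrite -ext // => [|c cs]; last by rewrite mem_cat cs orbT.
  by rewrite E subrr.
have hG c : G c \in gm_comp M c.
  by apply: rpredB; case: ifP => _; rewrite ?rpred0 ?(hg c).1.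
have du : d \in u by rewrite mem_undup mem_cat ds.
have /eqP := gm_direct (undup_uniq _) hG G0 du.
rewrite /G ds subr_eq0 (hg d).2 => /eqP ->.
apply/quotmod_pi_eq0.
by case: ifP => _ //; rewrite rpred0.
Qed.

Definition quot_graded : gradedModule :=
  @GradedModule (quotmod N) (fun d => quot_comp d)
    quot_comp_scale quot_comp_span quot_comp_direct.

End QuotientGraded.

Definition poly_comp (d : int) : {pred R^o} :=
  [pred p | if d is Posz e then p \is e.-homog else p == 0].

Lemma poly_comp_closed d : zmod_closed (poly_comp d).
Proof.
case: d => d; split=> [|p q]; rewrite !inE ?dhomog0 //.
  by move=> hp hq; rewrite rpredB.
by move=> /eqP -> /eqP ->; rewrite subrr.
Qed.

HB.instance Definition _ d :=
  GRing.isZmodClosed.Build R^o (poly_comp d) (poly_comp_closed d).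

Lemma poly_comp_scale (e : nat) (d : int) (p : R) (q : R^o) :
  p \is e.-homog -> q \in poly_comp d -> p *: q \in poly_comp (e%:Z + d).
Proof.
case: d => [d|d] hp; rewrite inE; first by move=> hq; exact: dhomogM.
by move=> /eqP ->; rewrite scaler0 rpred0.
Qed.

Definition hcomp (p : R) (d : int) : R :=
  if d is Posz e then pihomog mdeg e p else 0.

Lemma hcomp_in p d : hcomp p d \in poly_comp d.
Proof. by case: d => [d|d] /=; rewrite inE //= pihomogP. Qed.

Lemma hcomp_sum (p : R) : p = \sum_(d <- map Posz (iota 0 (msize p))) hcomp p d.
Proof.
rewrite big_map {1}[p](pihomog_partitionE (leqnn (mmeasure mdeg p))).
by rewrite -(big_mkord xpredT (fun d => pihomog mdeg d p)) /index_iota subn0.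
Qed.

Lemma poly_comp_span (p : R^o) : exists (s : seq int) (f : int -> R^o),
  [/\ uniq s, forall d, f d \in poly_comp d & p = \sum_(d <- s) f d].
Proof.
exists (map Posz (iota 0 (msize p))), (hcomp p); split; last exact: hcomp_sum.
  by rewrite map_inj_uniq ?iota_uniq // => ? ? [].
exact: hcomp_in.
Qed.

Lemma poly_comp_direct (s : seq int) (f : int -> R^o) :
  uniq s -> (forall d, f d \in poly_comp d) -> \sum_(d <- s) f d = 0 ->
  forall d, d \in s -> f d = 0.
Proof.
move=> us hf E [d|d] ds; last exact/eqP/(hf (Negz d)).
have := congr1 (pihomog mdeg d) E.
rewrite raddf0 raddf_sum (bigD1_seq _ ds us) /= big1_seq => [|c /andP[cd _]].
  by rewrite addr0 pihomog_dE //; apply: (hf (Posz d)).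
case: c cd (hf c) => [c|c] cd; rewrite inE => hc; last by rewrite (eqP hc) raddf0.
by rewrite (pihomog_ne0 _ hc).
Qed.

Definition poly_graded : gradedModule :=
  @GradedModule R^o (fun d => poly_comp d)
    poly_comp_scale poly_comp_span poly_comp_direct.

Lemma ideal_gen_graded (S : R -> Prop) :
  (forall p, S p -> exists d : nat, p \is d.-homog) ->
  graded_sub (M := poly_graded) (ideal_gen S).
Proof.
move=> hS p /asboolP[s [Ss Ep]].
exists (map Posz (iota 0 (msize p))), (hcomp p); split.
- by rewrite map_inj_uniq ?iota_uniq // => ? ? [].
- exact: hcomp_in.
- move=> [d|d]; last exact: rpred0.
  rewrite /= Ep raddf_sum /= big_seq rpred_sum // => -[a b] /Ss Sb.
  have [c hb] := hS _ Sb.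
  have Ib : (b : R^o) \in ideal_gen S.
    apply/asboolP; exists [:: (1, b)]; split=> [g|].
      by rewrite inE => /eqP ->.
    by rewrite big_seq1 mul1r.
  rewrite [a](pihomog_partitionE (leqnn (mmeasure mdeg a))) /=.
  rewrite mulr_suml raddf_sum rpred_sum // => i _.
  have hi := dhomogM (pihomogP mdeg i a) hb.
  have [Ei|ne] := eqVneq (i + c)%N d.
    rewrite Ei in hi; rewrite [X in X \in _](pihomog_dE hi).
    exact: (@rpredZ R R^o (ideal_gen S) _ b Ib).
  by rewrite [X in X \in _](pihomog_ne0 ne hi) rpred0.
- exact: hcomp_sum.
Qed.

End Graded.

Section PathIdeal.
Variables (k : fieldType) (n : nat) (e : rel 'I_n) (root : 'I_n).

Definition simple_path (u v : 'I_n) (p : seq 'I_n) : Prop :=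
  [/\ path e u p, last u p = v & uniq (u :: p)].

Definition is_tree : Prop :=
  [/\ ssrbool.symmetric e, irreflexive e &
      forall u v, u != v -> exists! p, simple_path u v p].

(* the edge {u, v} of the tree is directed from u to v when it is the last edge of the
   path from the root to v *)
Definition directed_edge (u v : 'I_n) : Prop :=
  e u v /\ exists p, simple_path root v (rcons p v) /\ last root p = u.

Definition is_dpath (t : nat) (s : t.-tuple 'I_n) : Prop :=
  forall i j : 'I_t, j = i.+1 :> nat -> directed_edge (tnth s i) (tnth s j).

Definition path_monomial (t : nat) (p : {mpoly k[n]}) : Prop :=
  exists2 s : t.-tuple 'I_n, is_dpath s & p = \prod_(i <- s) 'X_i.

Definition path_ideal (t : nat) : submodClosed {mpoly k[n]}^o :=
  ideal_gen (path_monomial t).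

Lemma path_ideal_graded t : graded_sub (M := poly_graded k n) (path_ideal t).
Proof.
apply: ideal_gen_graded => p [s _ ->]; exists t.
rewrite -[X in X.-homog](size_tuple s).
elim: (tval s) => [|i w IH]; first by rewrite big_nil dhomog1.
rewrite big_cons /= -add1n; apply: dhomogM IH.
by rewrite dhomogX; apply/eqP/mdeg1.
Qed.

End PathIdeal.

(* Main.v *)
(* If Delta is a complex with a nonpure shelling, write J_d for the Stanley-Reisner ideal of
   the subcomplex generated by the facets of size at least d. Removing facets in reverse
   shelling order filters J_(d+1) / J_d by modules isomorphic to R / P_F, with P_F generated
   by the variables outside a facet F of size d. The sequence of elementary symmetric
   polynomials e_d, ..., e_1 is regular on every such R / P_F, hence on J_(d+1) / J_d, whose
   dimension is d; so the J_d / I yield the filtration of R / I.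
   For the path ideal, Delta consists of the vertex sets containing no directed path of t
   vertices. It is shelled by induction inside the class of complexes whose minimal
   nonfaces are convex chains of a rooted forest, a class that is stable under the deletion
   and the link of the shedding face e \ {x}, where x is a deepest vertex and e the shortest
   chain through x. *)
Require Import Defs.
From HB Require Import structures.
From mathcomp Require Import all_boot all_order all_algebra.
From mathcomp Require Import ring_quotient boolp mpoly.
From mathcomp Require classical_sets.
From mathcomp Require Import ring zify.

Set Implicit Arguments.
Unset Strict Implicit.
Unset Printing Implicit Defensive.

Import GRing.Theory.

(** * Shellings of complexes of chains in a forest *)

Section Shelling.
Variable T : finType.
Implicit Types (A B F S W : {set T}) (D : pred {set T}) (L : seq ({set T} * {set T}))
  (p q : {set T} * {set T}).

Definition in_interval A (p : {set T} * {set T}) : bool := (p.1 \subset A) && (A \subset p.2).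

(* A nonpure shelling in partition form: the complex is the disjoint union of the
   intervals [p.1, p.2], p.2 running over the facets and p.1 being the restriction
   of p.2. The last clause is what allows one to reorder by dimension. *)
Record shelling D L : Prop := Shelling {
  sh_cover : forall A, D A = has (in_interval A) L;
  sh_sub : forall p, p \in L -> p.1 \subset p.2;
  sh_order : pairwise (fun p q : {set T} * {set T} => ~~ (q.1 \subset p.2)) L;
  sh_size : forall p q, p \in L -> q \in L -> p.1 \subset q.2 -> (#|q.2| <= #|p.2|)%N
}.

Lemma sh_facet D L p : shelling D L -> p \in L -> D p.2.
Proof.
move=> h pL; rewrite (sh_cover h); apply/hasP; exists p => //.
by rewrite /in_interval (sh_sub h pL) subxx.
Qed.

Definition cone_pair x (p : {set T} * {set T}) := (p.1, x |: p.2).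

Lemma subsetU1_notin x A B : x \notin A -> (A \subset x |: B) = (A \subset B).
Proof.
move=> xA; apply/subsetP/subsetP => h i iA; have := h i iA; rewrite !inE.
  by case/orP => // /eqP E; rewrite -E iA in xA.
by move=> ->; rewrite orbT.
Qed.

Lemma in_interval_cone x p A : x \notin p.1 ->
  in_interval A (cone_pair x p) = in_interval (A :\ x) p.
Proof.
move=> xp; rewrite /in_interval /= subsetD1 xp andbT; congr (_ && _).
by rewrite subDset.
Qed.

(** A set lies in a coned interval exactly when it lies in the old one after removal of [x]; as no
    face contains [x], all facets grow by one and size comparisons survive. *)
Lemma cone_shelling D L x :
  shelling D L -> (forall F, D F -> x \notin F) ->
  shelling (fun A => D (A :\ x)) [seq cone_pair x p | p <- L].
Proof.
move=> h hx.
have x2 p : p \in L -> x \notin p.2 by move=> pL; apply/hx/(sh_facet h pL).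
have x1 p : p \in L -> x \notin p.1.
  by move=> pL; apply: contra (x2 p pL); apply/subsetP/(sh_sub h).
split.
- move=> A; rewrite (sh_cover h) has_map; apply: eq_in_has => p pL /=.
  by rewrite in_interval_cone ?x1.
- move=> _ /mapP[p pL ->] /=; apply: subset_trans (sh_sub h pL) _.
  exact: subsetUr.
- rewrite pairwise_map; apply: (sub_in_pairwise _ (allss L) (sh_order h)).
  by move=> p q pL qL /=; rewrite subsetU1_notin ?x1.
move=> _ _ /mapP[p pL ->] /mapP[q qL ->] /=; rewrite subsetU1_notin ?x1 // => pq.
by rewrite !cardsU1 !x2 // leq_add2l; apply: (sh_size h).
Qed.

(** [D1] is the base of the cone with apex [x] and [D2] the link of [S]. The cone comes first, since
    the later restrictions contain [S] and no facet of the cone does. The last hypothesis serves the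
    size condition between the two parts. *)
Lemma shed_shelling D1 D2 L1 L2 S x :
  shelling D1 L1 -> shelling D2 L2 -> x \notin S ->
  (forall F, D1 F -> x \notin F /\ ~~ (S \subset F)) ->
  (forall F, D2 F -> [disjoint F & S]) ->
  (forall F s, D2 F -> s \in S -> D1 ((S :\ s) :|: F)) ->
  shelling (fun A => if S \subset A then D2 (A :\: S) else D1 (A :\ x))
    ([seq cone_pair x p | p <- L1] ++ [seq (S :|: p.1, S :|: p.2) | p <- L2]).
Proof.
move=> h1 h2 xS hD1 hD2 hD12.
have c1 := cone_shelling h1 (fun F DF => (hD1 F DF).1).
have x2 p : p \in L1 -> x \notin p.2 by move=> pL; case: (hD1 _ (sh_facet h1 pL)).
have nS p : p \in L1 -> ~~ (S \subset p.2) by move=> pL; case: (hD1 _ (sh_facet h1 pL)).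
have dj2 p : p \in L2 -> [disjoint p.2 & S] by move=> /(sh_facet h2); apply: hD2.
have dj1 p : p \in L2 -> [disjoint p.1 & S].
  by move=> pL; apply: disjointWl (sh_sub h2 pL) (dj2 p pL).
have subS A B : [disjoint A & S] -> (S :|: A \subset S :|: B) = (A \subset B).
  move=> dA; apply/idP/idP => [|AB]; last exact: setUS.
  rewrite subUset => /andP[_ /subsetP h]; apply/subsetP => i iA.
  by have := h i iA; rewrite inE (disjointFr dA iA).
split.
- move=> A; rewrite has_cat; case: ifP => SA.
    rewrite [X in X || _](_ : _ = false); last first.
      apply/hasP => -[_ /mapP[p pL ->]] /andP[/= _ /(subset_trans SA)].
      by rewrite subsetU1_notin // (negbTE (nS _ pL)).
    rewrite (sh_cover h2) has_map; apply: eq_in_has => p pL /=.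
    rewrite /in_interval /= subsetD dj1 // andbT subUset SA /=.
    by rewrite subDset.
  rewrite (sh_cover c1) [X in _ || X](_ : _ = false) ?orbF //.
  apply/hasP => -[_ /mapP[p pL ->]] /andP[/=].
  by rewrite subUset SA.
- move=> p; rewrite mem_cat => /orP[/(sh_sub c1) //|/mapP[q qL ->] /=].
  exact/setUS/(sh_sub h2).
- rewrite pairwise_cat (sh_order c1) /=; apply/andP; split.
    apply/allrelP => _ _ /mapP[p pL ->] /mapP[q qL ->] /=.
    rewrite subUset negb_and subsetU1_notin //.
    by rewrite nS.
  rewrite pairwise_map; apply: (sub_in_pairwise _ (allss L2) (sh_order h2)).
  by move=> p q pL qL /=; rewrite subS ?dj1.
move=> p q; rewrite !mem_cat => /orP[pL|/mapP[p' pL ->]] /orP[qL|/mapP[q' qL ->]].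
- exact: (sh_size c1).
(* The restriction [p'.1] misses some [s] of [S], hence lies in the face (S \ s) ∪ q'.2 of [D1].
   Some facet [l.2] of [D1] contains this face, so |S ∪ q'.2| - 1 <= |l.2| <= |p'.2|, and the apex
   makes up for the 1. *)
- case/mapP: pL => p' pL -> /= pq.
  have [s sS sp] : exists2 s, s \in S & s \notin p'.1.
    apply/subsetPn; apply: contra (nS _ pL) => /subset_trans; apply.
    exact: (sh_sub h1).
  have dB := hD12 _ _ (sh_facet h2 qL) sS.
  move: (dB); rewrite (sh_cover h1) => /hasP[l lL /andP[l1 l2]].
  have pB : p'.1 \subset S :\ s :|: q'.2.
    apply/subsetP => i ip; have := subsetP pq i ip; rewrite !inE.
    by case: eqP => // E; rewrite -E ip in sp.
  have := sh_size h1 pL lL (subset_trans pB l2).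
  have := subset_leq_card l2.
  have -> : #|S :|: q'.2| = #|S :\ s :|: q'.2|.+1.
    rewrite (cardsD1 s (S :|: q'.2)) inE sS /= add1n; congr _.+1.
    apply: eq_card => i; rewrite !inE; case: eqP => //= ->.
    by apply/esym/negbTE; rewrite (disjointFl (dj2 _ qL) sS).
  by move=> hl hp; rewrite cardsU1 x2 // add1n ltnS; apply: leq_trans hp.
- case/mapP: qL => q' qL -> /=; rewrite subUset subsetU1_notin //.
  by rewrite (negbTE (nS _ qL)).
move=> /=; rewrite subS ?dj1 // => pq.
rewrite !cardsU ![S :&: _]setIC !disjoint_setI0 ?dj2 // !cards0 !subn0 leq_add2l.
exact: (sh_size h2).
Qed.

End Shelling.

(** * Complexes whose nonfaces are generated by convex chains of a forest *)

Section ForestComplex.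
Variables (T : finType) (le : rel T) (rank : T -> nat).
Hypothesis le_refl : forall u, le u u.
Hypothesis le_rank : forall u v, le u v -> u != v -> (rank u < rank v)%N.
Hypothesis le_forest : forall u v w, le u w -> le v w -> le u v || le v u.
Implicit Types (A B e W : {set T}) (H : {set {set T}}).

(** Convexity is relative to the remaining vertex set [W], so it survives the deletion of vertices
    outside [e]. *)
Definition convex_chain W e : Prop :=
  [/\ e \subset W, forall u v, u \in e -> v \in e -> le u v || le v u &
      forall u v w, u \in e -> v \in e -> w \in W -> le u w -> le w v -> w \in e].

(** With [set0 \in H] the complex is void, without even the empty face; the induction meets this
    case when the shortest edge is a single vertex. *)
Definition avoids W H A : bool :=
  (A \subset W) && [forall e in H, ~~ (e \subset A)].

Lemma avoidsP W H A :
  reflect (A \subset W /\ forall e, e \in H -> ~~ (e \subset A)) (avoids W H A).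
Proof. by apply: (iffP andP) => -[AW /forall_inP h]; split=> //; apply/forall_inP. Qed.

Lemma convex_chain_sub W W' e :
  convex_chain W e -> e \subset W' -> W' \subset W -> convex_chain W' e.
Proof.
move=> [_ ch cv] eW' W'W; split=> // u v w ue ve /(subsetP W'W).
exact: cv.
Qed.

(** Having maximal rank, [x] lies above all vertices of both chains, so [le_forest] compares a [u]
    in [e] but not in [e'] with any [w] in [e']. By convexity, [w] below [u] would force [u] into
    [e'], and [w] above [u] lies in [e]. *)
Lemma convex_chains_nested W e e' x :
  convex_chain W e -> convex_chain W e' -> x \in e -> x \in e' ->
  (forall w, w \in W -> (rank w <= rank x)%N) -> (e \subset e') || (e' \subset e).
Proof.
move=> [eW ch cv] [eW' ch' cv'] xe xe' top.
have lex w : w \in W -> le w x || le x w -> le w x.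
  move=> wW /orP[//|xw]; have [->//|ne] := eqVneq x w.
  by have := top w wW; rewrite leqNgt le_rank.
have [//|/subsetPn[u ue ue']] := boolP (e \subset e').
apply/orP; right; apply/subsetP => w we'.
have uW := subsetP eW u ue; have wW := subsetP eW' w we'.
have ux : le u x by apply: lex => //; apply: ch.
have wx : le w x by apply: lex => //; apply: ch'.
have /orP[uw|wu] := le_forest ux wx; first exact: (cv u x w).
by rewrite (cv' w x u) in ue'.
Qed.

(* Let x be a deepest vertex of W. The edges through x are nested; if e is the smallest,
   then S = e \ x is a shedding face: faces not containing S form a cone with apex x,
   and both the base of this cone and the link of S are again of the same kind. *)
Lemma avoids_shelling W H :
  (forall e, e \in H -> convex_chain W e) -> exists L, shelling (avoids W H) L.
Proof.
have [N] := ubnP #|W|; elim: N W H => // N IH W H; rewrite ltnS => hN hH.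
have [W0|[x0 x0W]] := set_0Vmem W.
  have [H0|H0] := boolP (set0 \in H).
    exists [::]; split=> // A /=; apply/avoidsP => -[_ /(_ _ H0)].
    by rewrite sub0set.
  exists [:: (set0, set0)]; split=> //=.
  - move=> A; rewrite /in_interval /= sub0set orbF; apply/avoidsP/idP; rewrite W0.
      by case.
    move=> A0; split=> // e eH; apply: contra H0 => /subset_trans/(_ A0).
    by rewrite subset0 => /eqP <-.
  - by move=> p; rewrite inE => /eqP ->.
  - by move=> p q; rewrite !inE => /eqP -> /eqP ->.
pose x := [arg max_(x > x0 in W) rank x].
have [xW top] : x \in W /\ forall w, w \in W -> (rank w <= rank x)%N.
  by rewrite /x; case: arg_maxnP.
have cWx : (#|W :\ x| < N)%N.
  by apply: leq_trans hN; rewrite (cardsD1 x W) xW.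
have [/exists_inP[e0 e0H xe0]|] := boolP [exists e in H, x \in e]; last first.
  rewrite negb_exists_in => /forall_inP nx.
  have [|L hL] := IH (W :\ x) H cWx.
    move=> e eH; apply: (convex_chain_sub (hH e eH)); last exact: subD1set.
    by rewrite subsetD1 nx // andbT; case: (hH e eH).
  exists [seq cone_pair x p | p <- L].
  have c := cone_shelling hL _; have {}c := c x _.
  case: c => [F /avoidsP[+ _]|c1 c2 c3 c4]; first by rewrite subsetD1 => /andP[].
  split=> // A; rewrite -c1; apply/avoidsP/avoidsP => -[AW h]; split.
  - exact: setSD.
  - by move=> e eH; rewrite subsetD1 nx // andbT; apply: h.
  - by rewrite -(setD1K xW) -subDset.
  by move=> e eH; have := h e eH; rewrite subsetD1 nx // andbT.
pose e := [arg min_(e < e0 | (e \in H) && (x \in e)) #|e|].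
have [eH xe emin] : [/\ e \in H, x \in e &
    forall e', e' \in H -> x \in e' -> (#|e| <= #|e'|)%N].
  rewrite /e; case: arg_minnP; rewrite ?e0H // => e1 /andP[h1 h2] h3; split=> // e' h4 h5.
  by apply: h3; rewrite h4.
have esub e' : e' \in H -> x \in e' -> e \subset e'.
  move=> e'H xe'; have /orP[//|e'e] := convex_chains_nested (hH e eH) (hH e' e'H) xe xe' top.
  by have /eqP <- : e' == e by rewrite eqEcard e'e emin.
pose S := e :\ x.
have [eW ech ecv] := hH e eH.
pose H' := [set e' in H | x \notin e'].
pose D1 := avoids (W :\ x) (S |: H').
(* A face containing [S] misses [x], as S ∪ {x} = [e]; this leaves no vertex of [e] in the link and
   disposes of every edge through [x]. *)
pose D2 := avoids (W :\: e) [set e' :\: S | e' in H'].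
have [L1 hL1] : exists L, shelling D1 L.
  apply: IH => // e' /setU1P[->|]; last first.
    rewrite inE => /andP[e'H xe']; apply: (convex_chain_sub (hH _ e'H)); last exact: subD1set.
    by rewrite subsetD1 xe' andbT; case: (hH _ e'H).
  split; first exact: setSD.
    by move=> u v /setD1P[_ ue] /setD1P[_ ve]; apply: ech.
  move=> u v w /setD1P[_ ue] /setD1P[_ ve] /setD1P[wx wW] uw wv.
  by rewrite !inE wx; apply: ecv uw wv.
have [L2 hL2] : exists L, shelling D2 L.
  apply: IH => [|_ /imsetP[e' e'H' ->]].
    apply: leq_trans hN; apply: proper_card; apply/properP; split; first exact: subsetDl.
    by exists x => //; rewrite inE xe.
  move: e'H'; rewrite inE => /andP[e'H xe']; have [e'W ch cv] := hH e' e'H; split.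
  - apply/subsetP => u; rewrite !inE negb_and negbK => /andP[h ue'].
    rewrite (subsetP e'W) // andbT; case/orP: h => // /eqP E; by rewrite -E ue' in xe'.
  - by move=> u v /setDP[ue _] /setDP[ve _]; apply: ch.
  move=> u v w /setDP[ue _] /setDP[ve _] /setDP[wW we] uw wv.
  rewrite !inE (negbTE we) andbF /=; exact: cv uw wv.
have hc := @shed_shelling _ D1 D2 L1 L2 S x hL1 hL2.
eexists; case: hc.
- by rewrite !inE eqxx.
- move=> F /avoidsP[FW hF]; split; last by apply: hF; apply: setU11.
  by move: FW; rewrite subsetD1 => /andP[].
- move=> F /avoidsP[FW _]; apply: disjointWl FW _.
  by rewrite -setI_eq0; apply/eqP/setP => i; rewrite !inE; case: (i \in e); rewrite ?andbF.
(* The set (S \ s) ∪ F does not contain [S], since [F] misses [s], nor an edge [e'] of [H'], since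
   [F] would then contain e' \ S. *)
- move=> F s /avoidsP[FW hF] sS; apply/avoidsP; split.
    apply/subsetP => i; rewrite !inE => /orP[/andP[_ /andP[-> ie]]|/(subsetP FW)].
      by rewrite (subsetP eW).
    by rewrite inE => /andP[ie ->]; rewrite andbT; apply: contraNneq ie => ->.
  move=> e' /setU1P[->|e'H'].
    apply/negP => /subsetP/(_ s sS); rewrite !inE eqxx /= => /(subsetP FW).
    by rewrite inE; case/setD1P: sS => _ ->.
  have := hF _ (imset_f _ e'H'); apply: contra => /subsetP h.
  apply/subsetP => i /setDP[ie' iS]; have := h i ie'; rewrite !inE.
  by case/orP => // /andP[_]; move: iS; rewrite !inE => /negbTE ->.
move=> c1 c2 c3 c4; split; [|exact: c2|exact: c3|exact: c4] => A; rewrite -c1 /=.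
have [SA|SA] := boolP (S \subset A).
  apply/avoidsP/avoidsP => -[AW h].
    have xA : x \notin A.
      apply: contra (h e eH) => xA; apply/subsetP => i ie.
      by have [->//|ix] := eqVneq i x; apply: (subsetP SA); rewrite !inE ix.
    split.
      apply/subsetP => i; rewrite !inE negb_and negbK => /andP[ix iA].
      rewrite (subsetP AW) // andbT; case/orP: ix => // /eqP E; by rewrite -E iA in xA.
    move=> _ /imsetP[e' + ->]; rewrite inE => /andP[e'H _].
    apply: contra (h e' e'H) => /subsetP e'A; apply/subsetP => i ie'.
    have [/(subsetP SA) //|iS] := boolP (i \in S).
    by have /setDP[] : i \in A :\: S by apply: e'A; apply/setDP.
  have xA : x \notin A.
    apply/negP => xA; have := subsetP AW x; rewrite !inE eqxx xA xe.
    by move/(_ isT).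
  split.
    apply/subsetP => i iA; have [|iS] := boolP (i \in S).
      by rewrite inE => /andP[_]; apply: (subsetP eW).
    have /setDP[] // : i \in W :\: e by apply: (subsetP AW); apply/setDP.
  move=> e' e'H; have [xe'|xe'] := boolP (x \in e').
    by apply: contra xA => /subsetP; apply.
  have e'H' : e' \in H' by rewrite inE e'H.
  by apply: contra (h _ (imset_f (fun f => f :\: S) e'H')) => e'A; apply: setSD.
apply/avoidsP/avoidsP => -[AW h]; split.
- exact: setSD.
- move=> e' /setU1P[->|]; first by rewrite subsetD1 negb_and SA.
  by rewrite inE => /andP[e'H _]; rewrite subsetD1 negb_and h.
- by rewrite -(setD1K xW) -subDset.
move=> e' e'H; have [xe'|xe'] := boolP (x \in e').
  apply: contra SA; apply: subset_trans; apply: subset_trans (esub e' e'H xe').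
  exact: subD1set.
by have := h e'; rewrite !inE e'H xe' orbT subsetD1 xe' andbT => /(_ isT).
Qed.

End ForestComplex.

Local Open Scope ring_scope.

(** * Weakly regular sequences and prime chains *)

Section WeaklyRegular.
Variable A : comNzRingType.

Definition is_submod (V : lmodType A) (N : V -> Prop) : Prop :=
  N 0 /\ forall a x y, N x -> N y -> N (a *: x + y).

Definition add_mul (V : lmodType A) (N M : V -> Prop) (a : A) (x : V) : Prop :=
  exists m y, [/\ M m, N y & x = m + a *: y].

Fixpoint add_seq_mul (V : lmodType A) (s : seq A) (N M : V -> Prop) : V -> Prop :=
  if s is a :: s' then add_seq_mul s' N (add_mul N M a) else M.

(** Weak regularity of [s] on N / M: dividing by [a] enlarges [M] to M + aN and keeps [N], so no
    quotient module is formed. *)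
Fixpoint wreg (V : lmodType A) (s : seq A) (N M : V -> Prop) : Prop :=
  if s is a :: s' then
    (forall x, N x -> M (a *: x) -> M x) /\ wreg s' N (add_mul N M a)
  else True.

Lemma submodB (V : lmodType A) (N : V -> Prop) x y :
  is_submod N -> N x -> N y -> N (x - y).
Proof. by case=> _ h Nx Ny; rewrite addrC -scaleN1r; apply: h. Qed.

Lemma submodD (V : lmodType A) (N : V -> Prop) x y :
  is_submod N -> N x -> N y -> N (x + y).
Proof. by case=> _ h Nx Ny; rewrite -[x]scale1r; apply: h. Qed.

Lemma submodZ (V : lmodType A) (N : V -> Prop) a x :
  is_submod N -> N x -> N (a *: x).
Proof. by case=> N0 h Nx; rewrite -[_ *: _]addr0; apply: h. Qed.

Lemma add_mul_submod (V : lmodType A) (N M : V -> Prop) a :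
  is_submod N -> is_submod M -> is_submod (add_mul N M a).
Proof.
move=> hN hM; split.
  by exists 0, 0; rewrite scaler0 addr0; case: hN hM => ? _ [? _].
move=> b _ _ [m [y [Mm Ny ->]]] [m' [y' [Mm' Ny' ->]]].
exists (b *: m + m'), (b *: y + y'); split.
- by apply: submodD => //; apply: submodZ.
- by apply: submodD => //; apply: submodZ.
by rewrite !scalerDr !scalerA [a * b]mulrC addrACA.
Qed.

Lemma add_mul_mono (V : lmodType A) (N M M' : V -> Prop) a x :
  (forall x, M x -> M' x) -> add_mul N M a x -> add_mul N M' a x.
Proof. by move=> h [m [y [Mm Ny ->]]]; exists m, y; split; auto. Qed.

Lemma add_seq_mul_mono (V : lmodType A) s (N M M' : V -> Prop) :
  (forall x, M x -> M' x) ->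
  forall x, add_seq_mul s N M x -> add_seq_mul s N M' x.
Proof.
elim: s M M' => [|a s IH] M M' h x //=; first exact: h.
by apply: IH => y; apply: add_mul_mono.
Qed.

(* a linear relation between V and V' that induces an isomorphism N / M ~ N' / M' *)
Record quot_rel (V V' : lmodType A) (rho : V -> V' -> Prop)
    (N M : V -> Prop) (N' M' : V' -> Prop) : Prop := QuotRel {
  qr_lin : forall a x x' y y', rho x y -> rho x' y' -> rho (a *: x + x') (a *: y + y');
  qr_tot : forall x, N x -> exists2 y, N' y & rho x y;
  qr_surj : forall y, N' y -> exists2 x, N x & rho x y;
  qr_ker : forall x y, N x -> N' y -> rho x y -> (M x <-> M' y)
}.

Lemma quot_rel_add_mul (V V' : lmodType A) rho (N M : V -> Prop)
    (N' M' : V' -> Prop) a :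
  is_submod N -> is_submod N' -> quot_rel rho N M N' M' ->
  quot_rel rho N (add_mul N M a) N' (add_mul N' M' a).
Proof.
move=> hN hN' h; split; [exact: qr_lin h | exact: qr_tot h | exact: qr_surj h |].
move=> x y Nx N'y r; split=> -[m [z [Mm Nz E]]].
  have [w N'w rw] := qr_tot h Nz; exists (- a *: w + y), w; split=> //; last first.
    by rewrite scaleNr addrAC addNr add0r.
  have rr := qr_lin h (- a) rw r.
  apply/(qr_ker h _ _ rr); [exact: (proj2 hN) | exact: (proj2 hN') |].
  by rewrite E scaleNr addrCA addNr addr0.
have [w Nw rw] := qr_surj h Nz; exists (- a *: w + x), w; split=> //; last first.
  by rewrite scaleNr addrAC addNr add0r.
have rr := qr_lin h (- a) rw r.
apply/(qr_ker h _ _ rr); [exact: (proj2 hN) | exact: (proj2 hN') |].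
by rewrite E scaleNr addrCA addNr addr0.
Qed.

Lemma quot_rel_add_seq_mul (V V' : lmodType A) rho s (N M : V -> Prop)
    (N' M' : V' -> Prop) :
  is_submod N -> is_submod N' -> quot_rel rho N M N' M' ->
  quot_rel rho N (add_seq_mul s N M) N' (add_seq_mul s N' M').
Proof.
move=> hN hN'; elim: s M M' => [|a s IH] M M' h //=.
by apply: IH; apply: quot_rel_add_mul.
Qed.

Lemma quot_rel_wreg (V V' : lmodType A) rho s (N M : V -> Prop)
    (N' M' : V' -> Prop) :
  is_submod N -> is_submod N' -> quot_rel rho N M N' M' ->
  wreg s N M -> wreg s N' M'.
Proof.
move=> hN hN'; elim: s M M' => [|a s IH] M M' h //= [ra rs]; split.
  move=> y N'y May; have [x Nx r] := qr_surj h N'y.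
  (* Subtracting the related pair from itself relates 0 to 0, which turns [qr_lin] into
     compatibility with scaling by [a]. *)
  have rs' := qr_lin h (- 1) r r.
  have rz := qr_lin h a r rs'; rewrite !scaleN1r !addNr !addr0 in rz.
  apply/(qr_ker h Nx N'y r)/ra => //.
  by apply/(qr_ker h _ _ rz) => //; apply: submodZ.
by apply: IH rs; apply: quot_rel_add_mul.
Qed.

(** Since [a] is regular on N2 / N1, an element of aN2 that lies in N1 lies in aN1. Hence N1 / (N0 +
    aN1) ~ (N1 + aN2) / (N0 + aN2), and the extension survives division by [a]. *)
Lemma wreg_ext (V : lmodType A) s (N0 N1 N2 : V -> Prop) :
  is_submod N0 -> is_submod N1 -> is_submod N2 ->
  (forall x, N0 x -> N1 x) -> (forall x, N1 x -> N2 x) ->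
  wreg s N1 N0 -> wreg s N2 N1 -> wreg s N2 N0.
Proof.
move=> h0 h1 h2 s01 s12; elim: s N0 N1 h0 h1 s01 s12 => [|a s IH] //= N0 N1.
move=> h0 h1 s01 s12 [r1 w1] [r2 w2]; split.
  by move=> x N2x ax; apply: r1 => //; apply: r2 => //; apply: s01.
have s02 x : N0 x -> N2 x by move/s01/s12.
apply: (IH _ _ _ _ _ _ _ w2); try exact: add_mul_submod.
- by move=> x; apply: add_mul_mono.
- by move=> _ [m [y [Nm Ny ->]]]; apply: submodD; auto; apply: submodZ.
apply: (@quot_rel_wreg V V (fun x y => add_mul N2 (fun z => z = 0) a (y - x))) w1 => //.
  exact: add_mul_submod.
split=> [b x x' y y'|x N1x|y [m [z [N1m N2z ->]]]|x y N1x _ [m [w [-> N2w E]]]].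
- move=> [_ [z [-> N2z E]]] [_ [z' [-> N2z' E']]].
  exists 0, (b *: z + z'); split=> //; first exact: (proj2 h2).
  rewrite opprD addrACA -scalerBr E E' !add0r.
  by rewrite scalerDr !scalerA [b * a]mulrC.
- exists x; last by exists 0, 0; rewrite subrr scaler0 addr0; case: h2.
  by exists x, 0; rewrite scaler0 addr0; case: h2.
- by exists m => //; exists 0, z; rewrite [_ + a *: z]addrC addrK add0r.
have {}E : y = x + a *: w by apply/eqP; rewrite addrC -subr_eq E add0r.
split=> -[m' [z [N0m N1z E2]]].
  exists m', (z + w); split=> //; first by apply: submodD; auto.
  by rewrite E E2 scalerDr addrA.
exists m', (z - w); split=> //; last first.
  by rewrite scalerBr addrA -E2 E addrK.
apply: r2; first by apply: submodB.
suff -> : a *: (z - w) = x - m' by apply: submodB; auto.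
by apply/eqP; rewrite scalerBr subr_eq addrAC -E E2 addrAC subrr add0r.
Qed.

Lemma add_seq_mulP (V : lmodType A) (s : seq A) (M : V -> Prop) x :
  add_seq_mul s (fun=> True) M x <->
  exists2 m, M m & in_seq_mul s (x - m).
Proof.
elim: s M x => [|a s IH] M x /=.
  split=> [Mx|[m Mm [y]]]; first by exists x => //; exists (fun=> 0); rewrite big_ord0 subrr.
  by rewrite big_ord0 => /eqP; rewrite subr_eq0 => /eqP ->.
rewrite IH; split=> [[_ [m [y [Mm _ ->]]] [z E]]|[m Mm [y E]]].
  exists m => //; exists (fun i => if i is i'.+1 then z i' else y).
  by rewrite big_ord_recl /= -E opprD [x + (_ + _)]addrA [RHS]addrC subrK.
exists (m + a *: y 0%N); first by exists m, (y 0%N).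
by exists (y \o succn); rewrite opprD addrA E big_ord_recl /= addrC addKr.
Qed.

Lemma wregP (V : lmodType A) (s : seq A) (M : V -> Prop) :
  wreg s (fun=> True) M <->
  (forall i, (i < size s)%N -> forall x : V,
     add_seq_mul (take i s) (fun=> True) M (s`_i *: x) ->
     add_seq_mul (take i s) (fun=> True) M x).
Proof.
elim: s M => [|a s IH] M //=; rewrite IH; split=> [[h1 h2] [|i] his x|h].
- by rewrite take0; apply: h1.
- exact: h2.
by split=> [x _|i his x]; [have := h 0%N isT x; rewrite take0 | apply: (h i.+1)].
Qed.

Lemma in_seq_mulE (V : lmodType A) (s : seq A) (x : V) :
  in_seq_mul s x <-> add_seq_mul s (fun=> True) (fun z => z = 0) x.
Proof.
rewrite add_seq_mulP; split=> [h|[m -> ]]; last by rewrite subr0.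
by exists 0; rewrite ?subr0.
Qed.

Lemma regular_seqE (V : lmodType A) (s : seq A) :
  regular_seq V s <->
  wreg s (fun _ : V => True) (fun z => z = 0) /\
  exists x : V, ~ add_seq_mul s (fun=> True) (fun z => z = 0) x.
Proof.
rewrite wregP; split=> -[h1 [x hx]]; split; try by exists x; move/in_seq_mulE.
  by move=> i his y /in_seq_mulE /h1 -/(_ his) /in_seq_mulE.
by move=> i his y /in_seq_mulE /h1 -/(_ his) /in_seq_mulE.
Qed.

End WeaklyRegular.

(** * Prime ideals avoiding a multiplicative set, and prime chains from regular sequences *)

Section PrimeChains.
Variable A : comNzRingType.

(** An ideal maximal among those that contain [I] and miss the multiplicative set [S] is prime. *)
Lemma prime_avoiding (I S : A -> Prop) :
  is_submod (V := A^o) I -> S 1 -> (forall a b, S a -> S b -> S (a * b)) ->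
  (forall a, I a -> ~ S a) ->
  exists P : prime_idealr A, (forall a, I a -> a \in P) /\ (forall a, S a -> a \notin P).
Proof.
move=> hI S1 SM IS.
pose good (Q : A -> Prop) := [/\ is_submod (V := A^o) Q, forall a, I a -> Q a &
   forall a, Q a -> ~ S a].
pose T (Q : A -> Prop) := (forall a, ~ Q a) \/ good Q.
have [|Q [TQ maxQ]] := @classical_sets.Zorn_bigcup A T.
  move=> F FT tot.
  have [[X FX gX]|none] := pselect (exists2 X, F X & good X); last first.
    by left=> a [X FX Xa]; case: (FT _ FX) => [E|gX]; [case: (E a) | case: none; exists X].
  right; have [[X0 Xl] XI XS] := gX; split=> [|a Ia|a [Y FY Ya]].
  - split=> [|a x y [Y FY Yx] [Z FZ Zy]]; first by exists X.
    have [YZ|ZY] := tot _ _ FY FZ.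
      exists Z => //; case: (FT _ FZ) => [E|[[_ Zl] _ _]]; first by case: (E y).
      by apply: Zl => //; apply: YZ.
    exists Y => //; case: (FT _ FY) => [E|[[_ Yl] _ _]]; first by case: (E x).
    by apply: Yl => //; apply: ZY.
  - by exists X => //; apply: XI.
  - by case: (FT _ FY) => [E|[_ _ h]]; [case: (E a) | apply: h].
have gI : good I by [].
have gQ : good Q.
  case: TQ => // E; case: (maxQ I); last by right.
  by split=> [x /E //|/(_ 0) h]; apply: (E 0); apply: h; exact: hI.1.
have [hQ QI QS] := gQ.
have meetS a : ~ Q a -> exists q b, Q q /\ S (q + a * b).
  move=> nQa; apply: contrapT => none.
  case: (maxQ (fun x => add_mul (V := A^o) (fun=> True) Q a x)).
    split=> [x Qx|/(_ a) h]; first by exists x, 0; rewrite scaler0 addr0.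
    apply: nQa; apply: h; exists 0, 1; rewrite add0r.
    by split=> //; [exact: hQ.1 | rewrite /GRing.scale /= mulr1].
  right; split=> [|x Ix|_ [q [b [Qq _ ->]]] Sq].
  - by apply: add_mul_submod => //; split.
  - by exists x, 0; rewrite scaler0 addr0; split=> //; apply: QI.
  - by apply: none; exists q, b.
pose Qb : {pred A} := [pred a | `[< Q a >]].
have QbP a : reflect (Q a) (a \in Qb) by apply: asboolP.
have c1 : idealr_closed Qb.
  split=> [|| a x y /QbP Qx /QbP Qy]; first exact/QbP/(hQ.1).
    by apply/negP => /QbP /QS.
  by apply/QbP/(hQ.2).
have c2 : prime_idealr_closed Qb.
  move=> u v /QbP Quv; apply: contrapT => /negP; rewrite negb_or.
  case/andP=> /QbP /meetS[q [b [Qq Sq]]] /QbP /meetS[q' [b' [Qq' Sq']]].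
  apply: (QS _ _ (SM _ _ Sq Sq')).
  have -> : (q + u * b) * (q' + v * b') =
     (q' + v * b') *: (q : A^o) + ((u * b) *: (q' : A^o) + (b * b') *: (u * v : A^o)).
    by rewrite /GRing.scale /=; ring.
  by apply: hQ.2 => //; apply: hQ.2 => //; apply: submodZ.
pose m1 := isIdealr.Build A Qb c1.
pose m2 := isPrimeIdealrClosed.Build A Qb c2.
pose P : prime_idealr A := HB.pack Qb m1 m2.
exists P; split=> a => [/QI Qa|Sa]; first exact/QbP.
by apply/negP => /QbP /QS.
Qed.

Definition ann_mod (V : lmodType A) (M : V -> Prop) (a : A) : Prop :=
  forall x, M (a *: x).

Lemma ann_mod_submod (V : lmodType A) (M : V -> Prop) :
  is_submod M -> is_submod (V := A^o) (ann_mod M).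
Proof.
move=> hM; split=> [x|a b c hb hc x]; first by rewrite scale0r; case: hM.
by rewrite scalerDl -[a *: _]/(a * b) -scalerA; apply: (proj2 hM).
Qed.

(* If P contains the annihilator of V / (M + aV), then no a^i c with c outside P kills
   V / M; a prime containing ann_mod M and avoiding all these a^i c lies strictly below P. *)
Lemma wreg_prime_chain (V : lmodType A) s (M : V -> Prop) :
  is_submod M -> wreg s (fun=> True) M ->
  (exists x, ~ add_seq_mul s (fun=> True) M x) ->
  exists P : nat -> prime_idealr A,
    (forall i a, ann_mod M a -> a \in P i) /\
    (forall i, (i < size s)%N -> {subset P i <= P i.+1} /\
       exists2 a, a \in P i.+1 & a \notin P i).
Proof.
elim: s M => [|a s IH] M hM /=.
  move=> _ [x Mx]; have [||||P [h _]] := @prime_avoiding (ann_mod M) (fun b => b = 1).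
  - exact: ann_mod_submod.
  - by [].
  - by move=> b c -> ->; rewrite mulr1.
  - by move=> b hb b1; apply: Mx; have := hb x; rewrite b1 scale1r.
  by exists (fun=> P).
move=> [ra ws] px; have hT : is_submod (V := V) (fun=> True) by split.
have [P [P1 P2]] := IH _ (add_mul_submod a hT hM) ws px.
pose S b := exists i c, c \notin P 0%N /\ b = a ^+ i * c.
have [||||Q [Q1 Q2]] := @prime_avoiding (ann_mod M) S.
- exact: ann_mod_submod.
- by exists 0%N, 1; rewrite idealr1 expr0 mulr1.
- move=> _ _ [i [c [Pc ->]]] [j [d [Pd ->]]]; exists (i + j)%N, (c * d).
  by rewrite prime_idealrM negb_or Pc Pd exprD mulrACA.
- move=> b hb [i [c [/negP Pc E]]]; subst b; apply: Pc; apply: P1 => x.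
  exists (c *: x), 0; rewrite scaler0 addr0; split=> //.
  elim: i hb => [|i IHi] hb; first by have := hb x; rewrite expr0 mul1r.
  by apply: IHi => y; apply: ra => //; rewrite scalerA mulrA -exprS.
have QP : {subset Q <= P 0%N}.
  move=> b Qb; apply: contraT => Pb; rewrite -(negbTE (Q2 b _)) //.
  by exists 0%N, b; rewrite expr0 mul1r.
exists (fun i => if i is i'.+1 then P i' else Q); split.
  move=> [|i] b hb; first exact: Q1.
  by apply: P1 => x; exists (b *: x), 0; rewrite scaler0 addr0.
move=> [|i] his; last exact: P2.
(* [a] kills V / (M + aV) and so lies in [P 0], while a = a^1 * 1 belongs to [S], which [Q]
   avoids. *)
split=> //; exists a; last by apply: Q2; exists 1%N, 1; rewrite idealr1 expr1 mulr1.
by apply: P1 => x; exists 0, x; rewrite add0r; split=> //; case: hM.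
Qed.

(** Used in two ways: one regular sequence bounds the dimension from below, and the dimension bounds
    the length of all regular sequences. *)
Lemma regular_seq_prime_chain (V : lmodType A) s :
  regular_seq V s -> prime_chain V (size s).
Proof.
move=> /regular_seqE[ws px].
have h0 : is_submod (fun z : V => z = 0).
  by split=> // a x y -> ->; rewrite scaler0 addr0.
have [P [P1 P2]] := wreg_prime_chain h0 ws px.
exists (fun i => P i); split=> [i a ha|i j]; first by apply: P1 => x; apply: ha.
case: j => j /=; rewrite ltnS => hj; elim: j hj => [//|j IHj] hj.
rewrite ltnS leq_eqVlt => /orP[/eqP ->|ij]; first exact: P2.
have [s1 [a a1 a2]] := IHj (ltnW hj) ij.
have [s2 _] := P2 _ hj; split=> [x /s1 /s2 //|].
by exists a => //; apply: s2.
Qed.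

End PrimeChains.

(** * Krull dimension of Stanley-Reisner quotients *)

Section SquarefreeIdeals.
Variables (k : fieldType) (n : nat).
Local Notation R := {mpoly k[n]}.
Implicit Types (K : {set {set 'I_n}}) (m : 'X_{1..n}) (p q : R).

Definition mnm_set m : {set 'I_n} := [set i | m i != 0%N].

(* the Stanley-Reisner ideal of the simplicial complex generated by K *)
Definition face_ideal K : {pred R^o} :=
  [pred p : R | all (fun m => [forall A in K, ~~ (mnm_set m \subset A)]) (msupp p)].

Lemma face_idealP K p :
  reflect (forall m, m \in msupp p -> forall A, A \in K -> ~~ (mnm_set m \subset A))
          (p \in face_ideal K).
Proof.
apply: (iffP allP) => h m hm; last by apply/forall_inP => A; apply: h.
by move=> A AK; apply: (forall_inP (h m hm)).
Qed.

Lemma mnm_setD m1 m2 : mnm_set (m1 + m2)%MM = mnm_set m1 :|: mnm_set m2.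
Proof. by apply/setP => i; rewrite !inE mnmDE addn_eq0 negb_and. Qed.

Lemma mnm_set_mesym1 (A : {set 'I_n}) : mnm_set (mesym1 A) = A.
Proof. by apply/setP => i; rewrite inE mnmE; case: (i \in A). Qed.

Lemma mesym1_le (A : {set 'I_n}) m : (mesym1 A <= m)%MM = (A \subset mnm_set m).
Proof.
apply/idP/idP => [/mnm_lepP h|/subsetP h]; [apply/subsetP => i iA | apply/mnm_lepP => i].
  by rewrite inE -lt0n; apply: leq_trans (h i); rewrite mnmE iA.
by rewrite mnmE; case: (boolP (i \in A)) => // /h; rewrite inE -lt0n.
Qed.

Lemma face_ideal_closed K : submod_closed (face_ideal K).
Proof.
split=> [|a p q]; first by apply/face_idealP => m; rewrite msupp0.
move=> /face_idealP hp /face_idealP hq; apply/face_idealP => m /msuppD_le.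
rewrite mem_cat => /orP[|/hq //]; rewrite /GRing.scale /= => /msuppM_le.
case/allpairsP => -[m1 m2] /= [h1 h2 ->] A AK; rewrite mnm_setD subUset negb_and.
by rewrite (hp m2) ?orbT.
Qed.

HB.instance Definition _ K :=
  GRing.isSubmodClosed.Build R R^o (face_ideal K) (face_ideal_closed K).

End SquarefreeIdeals.

(** * Bounding the length of prime chains by counting monomials *)

Section KrullDimension.
Variables (k : fieldType) (n : nat).
Local Notation R := {mpoly k[n]}.

(** Modulo [P1] only the term of index 0 survives, so [w 0] is in [P1] and vanishes; the rest is a
    multiple of [a], which cancels because [a] is outside the prime [P0]. *)
Lemma power_sum_vanish (P0 P1 : prime_idealr R) (a : R) N (w : nat -> R) :
  {subset P0 <= P1} -> a \in P1 -> a \notin P0 ->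
  (forall j, (j < N)%N -> w j \in P1 -> w j = 0) ->
  \sum_(j < N) a ^+ j * w j \in P0 -> forall j, (j < N)%N -> w j = 0.
Proof.
move=> s01 a1 a0; elim: N w => [//|N IH] w hw.
rewrite big_ord_recl expr0 mul1r.
under eq_bigr => i _ do rewrite exprS -mulrA.
rewrite -mulr_sumr => h.
have w0 : w 0%N = 0.
  apply: hw => //; have := s01 _ h; rewrite rpredDr //.
  by rewrite mulrC idealMr.
move: h; rewrite w0 add0r prime_idealrM (negbTE a0) /= => h [|j] hj //.
by apply: (IH (w \o succn)) => // i hi; apply: hw.
Qed.

Lemma msizeM_leS (p q : R) a b :
  (msize p <= a.+1)%N -> (msize q <= b.+1)%N -> (msize (p * q) <= (a + b).+1)%N.
Proof.
have [->|p0] := eqVneq p 0; first by rewrite mul0r msize0.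
have [->|q0] := eqVneq q 0; first by rewrite mulr0 msize0.
by move=> hp hq; rewrite msizeM // -subn1 leq_subLR (leq_trans (leq_add hp hq)) // addSn addnS.
Qed.

(* The v i are the N ^ e monomials in a_0, ..., a_(e-1) with exponents smaller than N. *)
Lemma indep_family e (P : nat -> prime_idealr R) (a : nat -> R) N D :
  (forall i, (i < e)%N -> [/\ {subset P i <= P i.+1}, a i \in P i.+1 & a i \notin P i]) ->
  (forall i, (i < e)%N -> (msize (a i) <= D.+1)%N) ->
  exists (I : finType) (v : I -> R),
    [/\ #|I| = (N ^ e)%N, forall i, (msize (v i) <= (e * (N * D)).+1)%N &
        forall c : I -> k, \sum_i c i *: v i \in P 0%N -> forall i, c i = 0].
Proof.
elim: e P a => [|e IH] P a hP hD.
  exists unit, (fun=> 1); split=> [|i|c]; rewrite ?card_unit ?msize1 //.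
  rewrite (big_pred1 tt) => [h []|[]] //.
  apply: contraTeq h => c0; apply/negP => /(idealMr (c tt)^-1%:MP).
  by rewrite mul_mpolyC scalerA mulVf // scale1r idealr1.
have [I [v [cI sv iv]]] :
  exists (I : finType) (v : I -> R),
    [/\ #|I| = (N ^ e)%N, forall i, (msize (v i) <= (e * (N * D)).+1)%N &
        forall c : I -> k, \sum_i c i *: v i \in P 1%N -> forall i, c i = 0].
  by apply: (IH (P \o succn) (a \o succn)) => i hi; [apply: (hP i.+1) | apply: hD].
have [s01 a1 a0] := hP 0%N isT.
have sa j : (msize (a 0%N ^+ j) <= (j * D).+1)%N.
  elim: j => [|j IHj]; first by rewrite expr0 msize1.
  by rewrite exprS mulSn; apply: msizeM_leS => //; apply: hD.
exists ('I_N * I)%type, (fun ji : 'I_N * I => a 0%N ^+ ji.1 * v ji.2); split=> [|[j i]|c].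
- by rewrite card_prod card_ord cI expnS.
- rewrite mulSn; apply: msizeM_leS (sv i); apply: leq_trans (sa j) _.
  by rewrite ltnS leq_mul2r ltnW ?orbT.
pose w j := if insub j is Some j' then \sum_i c (j', i) *: v i else 0.
have wE (j : 'I_N) : w j = \sum_i c (j, i) *: v i by rewrite /w valK.
have -> : \sum_ji c ji *: (a 0%N ^+ ji.1 * v ji.2) = \sum_(j < N) a 0%N ^+ j * w j.
  rewrite (eq_bigr (fun ji => c (ji.1, ji.2) *: (a 0%N ^+ ji.1 * v ji.2))); last by case.
  rewrite -(pair_big xpredT xpredT
     (fun (j : 'I_N) i => c (j, i) *: (a 0%N ^+ j * v i))) /=.
  apply: eq_bigr => j _; rewrite wE mulr_sumr; apply: eq_bigr => i _.
  by rewrite scalerAr.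
move=> h [j i].
have w0 : w j = 0.
  apply: (power_sum_vanish s01 a1 a0 _ h) => // j' hj'.
  rewrite -[j']/(val (Ordinal hj')) wE => /iv c0; apply: big1 => i' _.
  by rewrite c0 scale0r.
by apply: (iv (fun i => c (j, i))); rewrite -wE w0 rpred0.
Qed.

(* Modulo P_0, the family above lives in the span of the monomials of bounded degree in
   the #|G| variables of G, of which there are O(N ^ #|G|). *)
Lemma krull_face_ideal (G : {set 'I_n}) e (P : nat -> prime_idealr R) (a : nat -> R) :
  {subset face_ideal [set G] <= P 0%N} ->
  (forall i, (i < e)%N -> [/\ {subset P i <= P i.+1}, a i \in P i.+1 & a i \notin P i]) ->
  (e <= #|G|)%N.
Proof.
move=> GP hP; rewrite leqNgt; apply/negP => Ge.
pose D := (\sum_(i < e) msize (a i))%N.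
have hD i : (i < e)%N -> (msize (a i) <= D.+1)%N.
  by move=> hi; rewrite /D (bigD1 (Ordinal hi)) //= -addnS leq_addr.
(* [M] exceeds every degree in the family, and M <= cN. As N > c^|G|, it follows that M^|G| <=
   (cN)^|G| < N^(|G|+1) <= N^e: there are more polynomials than monomials in [G] with exponents
   below [M]. *)
pose c := (e * D.+1)%N; pose N := (c ^ #|G|).+1; pose M := (e * (N * D)).+1.
have e0 : (0 < e)%N by apply: leq_ltn_trans Ge.
have MN : (M <= c * N)%N.
  have : (0 < e * N)%N by rewrite muln_gt0 e0.
  by rewrite /M /c; nia.
have cnt : (M ^ #|G| < N ^ e)%N.
  apply: (@leq_ltn_trans ((c * N) ^ #|G|)).
    by case: #|G| => // g; rewrite leq_exp2r.
  rewrite expnMn; apply: (@leq_trans (N * N ^ #|G|)%N).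
    by rewrite ltn_mul2r expn_gt0 /= ltnSn.
  by rewrite -expnS leq_pexp2l.
have [I [v [cI sv iv]]] := indep_family N hP hD.
pose T := [set f : {ffun 'I_n -> 'I_M} | f \in pffun_on ord0 (mem G) predT].
have cT : #|T| = (M ^ #|G|)%N by rewrite cardsE card_pffun_on card_ord.
pose mon (f : {ffun 'I_n -> 'I_M}) : 'X_{1..n} := [multinom (f i : nat) | i < n].
(* A vector in the left kernel of [B] is a linear relation between the [v i] modulo [face_ideal
   [set G]]. *)
pose B : 'M[k]_(#|I|, #|T|) := \matrix_(i, j) (v (enum_val i))@_(mon (enum_val j)).
have kB : kermx B != 0.
  rewrite kermx_eq0 /row_free neq_ltn; apply/orP; left.
  by apply: leq_ltn_trans (rank_leq_col _) _; rewrite cT cI.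
case/rowV0Pn: kB => r /sub_kermxP rB rn0.
move/negP: rn0; apply; apply/eqP/rowP => i; rewrite mxE.
rewrite -[i]enum_valK; apply: (iv (fun i => r 0 (enum_rank i))).
apply: GP; apply/face_idealP => m hm A /set1P ->.
move: hm; apply: contraL => mG; rewrite mcoeff_msupp negbK.
have [mM|mM] := ltnP (mdeg m) M; last first.
  apply/eqP/memN_msupp_eq0/msize_mdeg_ge; apply: leq_trans mM.
  apply: leq_trans (msize_sum _ _ _) _; apply/bigmax_leqP => j _.
  exact: leq_trans (msizeZ_le _ _) (sv _).
have hm j : (m j < M)%N.
  by apply: leq_ltn_trans mM; rewrite mdegE (bigD1 j) //= leq_addr.
pose f : {ffun 'I_n -> 'I_M} := [ffun j => Ordinal (hm j)].
have fT : f \in T.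
  rewrite inE; apply/pffun_onP; split=> //; apply/subsetP => j.
  rewrite inE ffunE -val_eqE /= => mj; apply: (subsetP mG); by rewrite inE.
have fm : mon f = m by apply/mnmP => j; rewrite mnmE ffunE.
have /rowP/(_ (enum_rank_in fT f)) := rB; rewrite !mxE => E.
rewrite raddf_sum -[X in _ == X]E (reindex (@enum_rank I)) /=; last first.
  by exists enum_val => j _; rewrite ?enum_rankK ?enum_valK.
apply/eqP/eq_bigr => j _; rewrite mxE enum_rankK enum_rankK_in // fm.
by rewrite mcoeffZ.
Qed.

End KrullDimension.

(** * Quotients of Stanley-Reisner ideals along a shelling *)

Section Layers.
Variables (k : fieldType) (n : nat).
Local Notation R := {mpoly k[n]}.
Implicit Types (K : {set {set 'I_n}}) (A B F : {set 'I_n}) (p q : R).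

Definition in_face_ideal K (p : R^o) : Prop := p \in face_ideal K.
Definition everything (V : Type) (x : V) : Prop := True.

Lemma in_face_ideal_submod K : is_submod (in_face_ideal K).
Proof.
by split=> [|a p q]; rewrite /in_face_ideal ?rpred0 // => hp hq; rewrite rpredD ?rpredZ.
Qed.

Lemma everything_submod (A : comNzRingType) (V : lmodType A) :
  is_submod (@everything V).
Proof. by []. Qed.

Lemma face_ideal_sub K K' p : K' \subset K -> p \in face_ideal K -> p \in face_ideal K'.
Proof.
move=> sK /face_idealP h; apply/face_idealP => m hm A AK.
by apply: h; rewrite ?(subsetP sK).
Qed.

Lemma face_idealU1 F K p :
  (p \in face_ideal (F |: K)) = (p \in face_ideal [set F]) && (p \in face_ideal K).
Proof.
apply/idP/andP => [h|[/face_idealP h1 /face_idealP h2]].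
  by split; apply: face_ideal_sub h; rewrite ?subsetUl ?subsetUr.
by apply/face_idealP => m hm A /setUP[/(h1 m hm) | /(h2 m hm)].
Qed.

Lemma face_idealMl K p q : q \in face_ideal K -> p * q \in face_ideal K.
Proof. exact: (@rpredZ R R^o (face_ideal K) p q). Qed.

Lemma face_ideal_mulX K A p :
  (p * 'X_[mesym1 A] \in face_ideal K) <->
  forall m, m \in msupp p -> forall B, B \in K -> ~~ (A :|: mnm_set m \subset B).
Proof.
split=> [/face_idealP h m hm B BK|h].
  rewrite -(mnm_set_mesym1 A) -mnm_setD; apply: h => //.
  by rewrite (perm_mem (msuppMX _ _)) map_f.
apply/face_idealP => m; rewrite (perm_mem (msuppMX _ _)) => /mapP[m' hm' ->] B BK.
by rewrite mnm_setD mnm_set_mesym1 h.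
Qed.

(** [A] is the restriction of [F]: the faces of [F] outside the complex generated by [K] form the
    interval from [A] to [F]. *)
Definition shells K A F : Prop :=
  [/\ A \subset F, forall B, B \in K -> ~~ (A \subset B) &
      forall B, B \subset F -> (forall C, C \in K -> ~~ (B \subset C)) -> A \subset B].

(** Multiplication by the squarefree monomial of [A] maps R / P_F, where P_F = [face_ideal [set F]],
    isomorphically onto the quotient for [K] and [F |: K]: a monomial supported in [F] but in no
    member of [K] is divisible by it. *)
Lemma shell_quot_rel K A F : shells K A F ->
  quot_rel (fun p q : R^o => q - (p : R) * 'X_[mesym1 A] \in face_ideal (F |: K))
    (@everything R^o) (in_face_ideal [set F])
    (in_face_ideal K) (in_face_ideal (F |: K)).
Proof.
move=> [AF AK sh]; split.
- move=> a p p' q q' h h'.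
  have -> : (a *: q + q') - ((a *: p + p' : R^o) : R) * 'X_[mesym1 A] =
     a *: (q - (p : R) * 'X_[mesym1 A] : R^o) + (q' - (p' : R) * 'X_[mesym1 A]).
    by rewrite /GRing.scale /=; ring.
  by rewrite rpredD ?rpredZ.
- move=> p _; exists ((p : R) * 'X_[mesym1 A]); last by rewrite subrr rpred0.
  by apply/face_ideal_mulX => m hm B /AK; apply: contra; rewrite subUset => /andP[].
- move=> q /face_idealP hq.
  (* Terms divisible by the monomial of [A] are divided by it; the others have support neither in
     [F] nor in a member of [K], so they vanish in the quotient. *)
  exists (\sum_(m <- msupp q | A \subset mnm_set m) q@_m *: 'X_[m - mesym1 A]) => //.
  rewrite mulr_suml [X in X - _]mpolyE (bigID (fun m => A \subset mnm_set m)) /=.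
  rewrite (eq_bigr (fun m => q@_m *: 'X_[m - mesym1 A] * 'X_[mesym1 A])); last first.
    by move=> m Am; rewrite -scalerAl -mpolyXD submK // mesym1_le.
  rewrite addrAC subrr add0r big_seq_cond rpred_sum // => m /andP[hm Am].
  apply/face_idealP => m' /msuppZ_le; rewrite msuppX inE => /eqP -> B.
  move=> /setU1P[->|]; last exact: hq.
  by apply: contra Am => /sh; apply; apply: hq.
- move=> p q _ hq hpq; rewrite /in_face_ideal.
  have -> : (q \in face_ideal (F |: K)) =
            ((p : R) * 'X_[mesym1 A] \in face_ideal (F |: K)).
    rewrite -[in LHS](subrK ((p : R) * 'X_[mesym1 A]) q).
    by apply: rpredDl.
  split=> [/face_idealP hp|/face_ideal_mulX hp].
    apply/face_ideal_mulX => m hm B; rewrite subUset negb_and.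
    move=> /setU1P[->|/AK -> //]; by rewrite (hp m hm) ?set11 ?orbT.
  apply/face_idealP => m hm B /set1P ->; have := hp m hm F (setU11 _ _).
  by rewrite subUset AF.
Qed.

(** Records a filtration of [face_ideal K] modulo [face_ideal K'] with one factor R / P_F for each
    facet [F] added. *)
Inductive layered (d : nat) : {set {set 'I_n}} -> {set {set 'I_n}} -> Prop :=
| layered_nil K : layered d K K
| layered_cons K K' A F :
    #|F| = d -> shells K A F -> layered d (F |: K) K' -> layered d K K'.

Lemma layered_sub d K K' : layered d K K' -> K \subset K'.
Proof.
by elim=> // {}K {}K' A F _ _ _; apply: subset_trans; apply: subsetUr.
Qed.

Lemma wreg_trivial (V : lmodType R) s (N M : V -> Prop) :
  is_submod N -> (forall x, N x -> M x) -> wreg s N M.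
Proof.
move=> hN; elim: s M => [|a s IH] M NM //=; split=> [x Nx _|]; first exact: NM.
by apply: IH => x Nx; exists x, 0; rewrite scaler0 addr0; split; [apply: NM | case: hN |].
Qed.

Lemma wreg_layered d s K K' :
  (forall F, #|F| = d -> wreg s (@everything R^o) (in_face_ideal [set F])) ->
  layered d K K' -> wreg s (in_face_ideal K) (in_face_ideal K').
Proof.
move=> hs; elim=> [{}K|{}K {}K' A F cF sh hl IH].
  by apply: wreg_trivial => //; apply: in_face_ideal_submod.
apply: (@wreg_ext _ _ _ _ (in_face_ideal (F |: K))); try exact: in_face_ideal_submod.
- by move=> x; apply: face_ideal_sub; apply: layered_sub hl.
- by move=> x; apply: face_ideal_sub; apply: subsetUr.
- exact: IH.
apply: (quot_rel_wreg _ _ (shell_quot_rel sh)) (hs _ cF) => //.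
exact: in_face_ideal_submod.
Qed.

(** The degrees descend because, for [F] of size d, e_d is the monomial of [F] modulo P_F, and
    dividing by it leaves a complex with facets of size d - 1. *)
Fixpoint esyms d : seq R := if d is d'.+1 then mesym n k d'.+1 :: esyms d' else [::].

Lemma size_esyms d : size (esyms d) = d.
Proof. by elim: d => //= d ->. Qed.

Definition boundary F A : {set {set 'I_n}} := [set F :\ g | g in A].

(** When F \ g is added after all F \ h with [h] in [A], its restriction is [A], so the facets of
    the boundary may come in any order. *)
Lemma boundary_layered d F A :
  #|F| = d.+1 -> A \subset F -> layered d (boundary F A) (boundary F F).
Proof.
move=> cF; have [N] := ubnP #|F :\: A|; elim: N A => // N IH A hN AF.
have [E|] := eqVneq (F :\: A) set0.
  have -> : A = F by apply/eqP; rewrite eqEsubset AF -setD_eq0 E eqxx.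
  exact: layered_nil.
case/set0Pn => g; rewrite inE => /andP[gA gF].
apply: (@layered_cons _ _ _ A (F :\ g)).
- by have := cardsD1 g F; rewrite gF cF => -[].
- split=> [|B /imsetP[h hA ->]|B BF hB].
  + by rewrite subsetD1 AF.
  + by apply/negP => /subsetP/(_ _ hA); rewrite !inE eqxx.
  apply/subsetP => h hA; apply: contraT => hnB.
  have /negP[] := hB (F :\ h) (imset_f _ hA).
  by rewrite subsetD1 hnB (subset_trans BF) ?subD1set.
have -> : F :\ g |: boundary F A = boundary F (g |: A).
  by rewrite /boundary imsetU1.
apply: IH; last by rewrite subUset sub1set gF.
rewrite -ltnS; apply: leq_trans hN; rewrite ltnS.
rewrite [X in (_ < X)%N](cardsD1 g) inE gA gF ltnS.
by apply: subset_leq_card; apply/subsetP => i; rewrite !inE negb_or -andbA.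
Qed.

Lemma boundary_shells F : shells (boundary F F) F F.
Proof.
split=> [//|B /imsetP[h hA ->]|B BF hB].
  by apply/negP => /subsetP/(_ _ hA); rewrite !inE eqxx.
apply/subsetP => h hA; apply: contraT => hnB.
have /negP[] := hB (F :\ h) (imset_f _ hA).
by rewrite subsetD1 hnB BF.
Qed.

Lemma mesym_face_ideal d K :
  (forall B, B \in K -> (#|B| < d)%N) -> mesym n k d \in face_ideal K.
Proof.
move=> hK; rewrite mesymE rpred_sum // => h /eqP ch.
apply/face_idealP => m; rewrite msuppX inE => /eqP -> B /hK; rewrite mnm_set_mesym1 -ch.
by apply: contraL => /subset_leq_card; rewrite -leqNgt.
Qed.

Lemma mesym_mod F : mesym n k #|F| - 'X_[mesym1 F] \in face_ideal [set F].
Proof.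
rewrite mesymE (bigD1 F) //= addrC addrK rpred_sum // => h /andP[/eqP ch hF].
apply/face_idealP => m; rewrite msuppX inE => /eqP -> B /set1P ->.
by rewrite mnm_set_mesym1; apply: contra hF => hs; rewrite eqEcard hs ch leqnn.
Qed.

(** Modulo P_F, e_(d+1) is the monomial of [F], which generates the boundary ideal there because [F]
    is the only face missing from its boundary. *)
Lemma face_ideal_boundary d F p : #|F| = d.+1 ->
  add_mul (@everything R^o) (in_face_ideal [set F]) (mesym n k d.+1) p <->
  in_face_ideal (boundary F F) p.
Proof.
move=> cF; have eF := mesym_mod F; rewrite cF in eF; split.
  move=> [m [y [/face_idealP hm _ ->]]]; rewrite /in_face_ideal rpredD //.
    apply/face_idealP => m' hm' B /imsetP[h hF ->].
    by apply: contra (hm _ hm' F (set11 _)) => /subset_trans; apply; apply: subD1set.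
  rewrite [_ *: _]mulrC; apply: face_idealMl; apply: mesym_face_ideal => B /imsetP[h hF ->].
  by rewrite -cF [X in (_ < X)%N](cardsD1 h) hF.
move=> /(qr_surj (shell_quot_rel (boundary_shells F)))[y _ h].
exists (p - mesym n k d.+1 *: y), y; split=> //; last by rewrite subrK.
have -> : p - mesym n k d.+1 *: y = (p - (y : R) * 'X_[mesym1 F]) -
    (y : R) * (mesym n k d.+1 - 'X_[mesym1 F]).
  by rewrite /GRing.scale /=; ring.
rewrite /in_face_ideal rpredB //; first by move: h; rewrite face_idealU1 => /andP[].
exact: face_idealMl.
Qed.

(* R / (P_F, e_d) = R / (P_F, x^F) is the Stanley-Reisner ring of the boundary of the
   simplex F, which is filtered by the quotients R / P_G with G of size d - 1. *)
Lemma esyms_wreg d F : #|F| = d ->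
  wreg (esyms d) (@everything R^o) (in_face_ideal [set F]).
Proof.
elim: d F => [|d IH] F cF //; split.
  move=> x _ h; have eF := mesym_mod F; rewrite cF in eF.
  have : (x : R) * 'X_[mesym1 F] \in face_ideal [set F].
    have -> : (x : R) * 'X_[mesym1 F] = mesym n k d.+1 *: x -
        (x : R) * (mesym n k d.+1 - 'X_[mesym1 F]).
      by rewrite /GRing.scale /=; ring.
    by rewrite rpredB // face_idealMl.
  move/face_ideal_mulX => hx; apply/face_idealP => m hm B /set1P ->.
  by have := hx m hm F (set11 _); rewrite subUset subxx.
(* With no facets the face ideal is all of R, so this layering filters R modulo the boundary
   ideal. *)
have hl : layered d set0 (boundary F F).
  by rewrite -[X in layered d X](imset0 (fun g => F :\ g));
    apply: boundary_layered; rewrite ?sub0set.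
have := wreg_layered (fun G cG => IH G cG) hl.
apply: (@quot_rel_wreg _ _ _ (fun x y : R^o => x = y)) => //.
  exact: in_face_ideal_submod.
split=> [a x x' y y' -> -> //|x|x _|x y _ _ ->]; first by exists x.
  by exists x => //; apply/face_idealP => m _ A; rewrite inE.
by rewrite face_ideal_boundary.
Qed.

Lemma mcoeff0_add_seq_mul s (M : R^o -> Prop) :
  (forall a : R, a \in s -> a@_0%MM = 0) -> (forall p : R, M p -> p@_0%MM = 0) ->
  forall p : R, add_seq_mul s (@everything R^o) M p -> p@_0%MM = 0.
Proof.
elim: s M => [|a s IH] M hs hM //=; apply: IH => [b bs|p].
  by apply: hs; rewrite inE bs orbT.
move=> [m [y [/hM m0 _ ->]]]; rewrite mcoeffD m0 add0r.
have -> : (a *: y : R)@_0%MM = a@_0%MM * (y : R)@_0%MM by exact: (rmorphM (mcoeff 0%MM)).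
by rewrite hs ?inE ?eqxx // mul0r.
Qed.

Lemma esyms_mcoeff0 d (a : R) : a \in esyms d -> a@_0%MM = 0.
Proof.
elim: d => //= d IH; rewrite inE => /orP[/eqP ->|/IH //].
by rewrite mcoeff_mesym /mechar mdeg0.
Qed.

Lemma mcoeff0_maximal_ideal p : p@_0%MM = 0 -> p \in @maximal_ideal k n.
Proof.
move=> p0; rewrite /maximal_ideal [p]mpolyE big_seq; apply: (@rpred_sum R^o) => m hm.
have [i mi] : exists i, m i != 0%N.
  apply/existsP; apply: contraLR hm; rewrite negb_exists => /forallP h.
  suff -> : m = 0%MM by rewrite mcoeff_msupp p0 eqxx.
  by apply/mnmP => i; rewrite mnm0E; apply/eqP; have := h i; rewrite negbK.
apply/asboolP; exists [:: (p@_m *: 'X_[m - U_(i)], 'X_i)]; split.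
  by move=> g; rewrite inE => /eqP ->; exists i.
rewrite big_seq1 /= -scalerAl -mpolyXD submK //.
by apply/mnm_lepP => j; rewrite mnm1E; case: eqP => [<-|//]; rewrite lt0n.
Qed.

(** In the first factor R / P_F the class of 1 survives division by [s], since constant terms vanish
    on P_F + (s); [K <> K'] provides a first factor. *)
Lemma layered_proper d s K K' :
  (forall a, a \in s -> a@_0%MM = 0) -> layered d K K' -> K <> K' ->
  exists2 x, in_face_ideal K x &
    ~ add_seq_mul s (in_face_ideal K) (in_face_ideal K') x.
Proof.
move=> hs [] // {}K {}K' A F cF sh hl _.
have [x Kx r] := qr_tot (shell_quot_rel sh) (I : everything (1 : R^o)).
exists x => // hx.
have hx' : add_seq_mul s (in_face_ideal K) (in_face_ideal (F |: K)) x.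
  by apply: add_seq_mul_mono hx => y; apply: face_ideal_sub; apply: layered_sub hl.
have qr := quot_rel_add_seq_mul s (@everything_submod _ R^o)
  (in_face_ideal_submod K) (shell_quot_rel sh).
move/(qr_ker qr I Kx r): hx' => /(mcoeff0_add_seq_mul hs) h.
have : (1 : R)@_0%MM = 0.
  apply: h => p /face_idealP hp; apply/eqP; rewrite mcoeff_eq0; apply/negP => /hp.
  move/(_ F (set11 _)) => /negP[]; apply/subsetP => i.
  by rewrite inE mnm0E.
by move/eqP; rewrite mcoeff1 eqxx oner_eq0.
Qed.

(** The product of the ideals P_F over the layer kills the quotient, so a prime containing the
    annihilator contains one of them. *)
Lemma layered_prime d K K' (P : prime_idealr R) :
  layered d K K' ->
  (forall a : R, (forall x : R, in_face_ideal K x -> in_face_ideal K' (a * x)) -> a \in P) ->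
  exists F, #|F| = d /\ {subset face_ideal [set F] <= P}.
Proof.
elim=> [{}K|{}K {}K' A F cF sh hl IH] hP.
  (* Without factors 1 annihilates the quotient, but no prime contains 1. *)
  have := hP 1; rewrite idealr1; case/(_ _)/Wrap => // x; by rewrite mul1r.
have [FP|nFP] := pselect {subset face_ideal [set F] <= P}; first by exists F.
have [a aF aP] : exists2 a : R, a \in face_ideal [set F] & a \notin P.
  apply: contrapT => none; apply: nFP => a aF; apply: contraT => aP.
  by case: none; exists a.
apply: IH => b hb; have : b * a \in P.
  apply: hP => x Kx; rewrite -mulrA; apply: hb.
  rewrite /in_face_ideal face_idealU1; apply/andP; split; last exact: face_idealMl.
  by rewrite mulrC; apply: face_idealMl.
by rewrite prime_idealrM (negbTE aP) orbF.
Qed.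

(** The sequence [esyms d] makes depth and dimension at least [d]. Every prime chain starts above
    some P_F with [F] of size [d], so its length is at most [d], and with it that of every regular
    sequence. *)
Lemma layered_dim_depth (V : lmodType R) rho d K K' :
  layered d K K' -> K <> K' ->
  quot_rel rho (in_face_ideal K) (in_face_ideal K') (@everything V) (fun z => z = 0) ->
  has_krull_dim V d /\ has_depth (@maximal_ideal k n) V d.
Proof.
move=> hl nK qr; have hK := in_face_ideal_submod K.
have hV : is_submod (@everything V) by [].
have reg : regular_seq V (esyms d).
  apply/regular_seqE; split.
    by apply: (quot_rel_wreg hK hV qr); apply: (wreg_layered _ hl) => F; apply: esyms_wreg.
  have [x Kx hx] := layered_proper (@esyms_mcoeff0 d) hl nK.
  have [y _ r] := qr_tot qr Kx; exists y => hy; apply: hx.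
  by apply/(qr_ker (quot_rel_add_seq_mul _ hK hV qr) Kx I r).
have dimV : has_krull_dim V d.
  split; first by have := regular_seq_prime_chain reg; rewrite size_esyms.
  move=> e [P [annP strP]].
  have [F [<- FP]] : exists F, #|F| = d /\ {subset face_ideal [set F] <= P ord0}.
    apply: (layered_prime hl) => a ha; apply: annP => y.
    have [x Kx r] := qr_surj qr (I : everything y).
    have := qr_lin qr (- 1) r r; rewrite !scaleN1r !addNr => r0.
    have := qr_lin qr a r r0; rewrite !addr0 => ra.
    by apply/(qr_ker qr _ _ ra) => //; [apply: submodZ | apply: ha].
  have strict i : (i < e)%N -> exists a : R, a \in P (inord i.+1) /\ a \notin P (inord i).
    move=> hi; have [|_ [a a1 a2]] := strP (inord i) (inord i.+1); last by exists a.
    by rewrite !inordK // ltnW.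
  have /choice[a ha] : forall i, exists a : R, (i < e)%N ->
      a \in P (inord i.+1) /\ a \notin P (inord i).
    move=> i; have [/strict[a ha]|_] := boolP (i < e)%N; first by exists a.
    by exists 0.
  apply: (@krull_face_ideal _ _ F e (fun i => P (inord i)) a).
    by move=> p /FP; congr (_ \in P _); apply: val_inj; rewrite /= inordK.
  move=> i hi; have [a1 a2] := ha i hi; split=> //.
  by have [|] := strP (inord i) (inord i.+1); rewrite ?inordK // ltnW.
split=> //; split.
  exists (esyms d); split=> //; first exact: size_esyms.
  by move=> a /esyms_mcoeff0; apply: mcoeff0_maximal_ideal.
by move=> s _ /regular_seq_prime_chain; apply: dimV.2.
Qed.

End Layers.

(** * Facets of a shelling grouped by size *)

Section Levels.
Variable n : nat.
Implicit Types (F : {set 'I_n}) (p q : {set 'I_n} * {set 'I_n}).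
Variables (D : pred {set 'I_n}) (L : seq ({set 'I_n} * {set 'I_n})).
Hypothesis shL : shelling D L.
Hypothesis downD : forall A B : {set 'I_n}, A \subset B -> D B -> D A.

Definition facets_ge (b : nat) : {set {set 'I_n}} :=
  [set F in [seq p.2 | p <- L & (b <= #|p.2|)%N]].

Lemma facets_geP b F :
  reflect (exists2 p, p \in L & F = p.2 /\ (b <= #|p.2|)%N) (F \in facets_ge b).
Proof.
rewrite inE; apply: (iffP mapP) => [[p + ->]|[p pL [-> bp]]].
  by rewrite mem_filter => /andP[bp pL]; exists p.
by exists p; rewrite ?mem_filter ?bp.
Qed.

(** Larger facets may come first, the facets of size [d] keeping their order in [L]: by [sh_size]
    the restriction of a facet of size [d] lies in no larger facet. *)
Lemma facets_layered b b' d :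
  (forall p, p \in L -> (b <= #|p.2| < b')%N -> #|p.2| = d) -> (b <= d < b')%N ->
  layered d (facets_ge b') (facets_ge b).
Proof.
move=> hd /andP[bd db'].
pose fs (l : seq ({set 'I_n} * {set 'I_n})) := [set F in [seq p.2 | p <- l & #|p.2| == d]].
have -> : facets_ge b = facets_ge b' :|: fs L.
  apply/setP => F; rewrite in_setU; apply/facets_geP/orP.
    move=> [p pL [-> bp]]; have [bp'|bp'] := leqP b' #|p.2|.
      by left; apply/facets_geP; exists p.
    right; rewrite inE; apply: map_f; rewrite mem_filter pL andbT.
    by apply/eqP/hd; rewrite ?bp.
  case=> [/facets_geP[p pL [-> bp]]|].
    by exists p => //; split=> //; apply: leq_trans bp; apply/ltnW/(leq_ltn_trans bd).
  rewrite inE => /mapP[p]; rewrite mem_filter => /andP[/eqP cp pL] ->.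
  by exists p => //; rewrite cp.
rewrite -[X in layered d X](_ : facets_ge b' :|: fs [::] = _); last first.
  by apply/setP => F; rewrite !inE orbF.
suff gen l1 l2 : L = l1 ++ l2 ->
    layered d (facets_ge b' :|: fs l1) (facets_ge b' :|: fs L) by exact: (gen [::] L).
elim: l2 l1 => [|p l2 IH] l1 E; first by rewrite [in fs L]E cats0; apply: layered_nil.
have pL : p \in L by rewrite E mem_cat inE eqxx orbT.
have {}IH := IH (rcons l1 p); rewrite cat_rcons in IH; have {}IH := IH E.
have [cp|cp] := eqVneq #|p.2| d; last first.
  by move: IH; rewrite /fs filter_rcons (negbTE cp).
have Efs : p.2 |: (facets_ge b' :|: fs l1) = facets_ge b' :|: fs (rcons l1 p).
  rewrite setUCA; congr (_ :|: _); apply/setP => F; rewrite !inE filter_rcons cp eqxx.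
  by rewrite map_rcons mem_rcons inE.
have := sh_order shL; rewrite [X in pairwise _ X]E pairwise_cat /=.
move=> /and3P[h12 h1 /andP[hp h2]].
rewrite -Efs in IH; apply: (layered_cons cp _ IH); split; first exact: (sh_sub shL).
  move=> B /setUP[/facets_geP[q qL [-> bq]]|].
    apply/negP => pq; have := sh_size shL pL qL pq.
    by rewrite cp leqNgt (leq_trans db' bq).
  rewrite inE => /mapP[q]; rewrite mem_filter => /andP[_ ql] ->.
  by have /allrelP/(_ q p ql) := h12; rewrite inE eqxx => /(_ isT).
(* [B] lies in the interval of some [q], and [q.2] has size at least [d] by [sh_size]. A larger or
   earlier [q.2] is excluded by [hB], a later one by [sh_order]; so q = p. *)
move=> B Bp hB; have : D B by apply: downD Bp _; apply: sh_facet shL pL.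
rewrite (sh_cover shL) => /hasP[q qL /andP[qB Bq]].
have qp := subset_trans qB Bp; have := sh_size shL qL pL qp; rewrite cp => dq.
have [bq|bq] := leqP b' #|q.2|.
  suff /hB : q.2 \in facets_ge b' :|: fs l1 by rewrite Bq.
  rewrite in_setU; apply/orP; left.
  by apply/facets_geP; exists q.
have cq : #|q.2| = d by apply: hd qL _; rewrite bq (leq_trans bd dq).
move: (qL); rewrite E mem_cat inE => /or3P[ql|/eqP <- //|ql].
  suff /hB : q.2 \in facets_ge b' :|: fs l1 by rewrite Bq.
  rewrite in_setU; apply/orP; right; rewrite inE.
  by apply: map_f; rewrite mem_filter cq eqxx.
by have := allP hp q ql; rewrite qp.
Qed.

End Levels.

(** * The filtration of R / I by images of face ideals *)

Section Filtration.
Variables (k : fieldType) (n : nat).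
Local Notation R := {mpoly k[n]}.
Variable I : submodClosed R^o.
Implicit Types (F : {set 'I_n}) (p q : R^o) (u : {set 'I_n} * {set 'I_n}).

Definition image_sub (J : {pred R^o}) : {pred quotmod I} :=
  [pred y | `[< exists2 p, p \in J & y = quotmod_pi I p >]].

Lemma image_sub_closed (J : submodClosed R^o) : submod_closed (image_sub J).
Proof.
split=> [|a x y]; first by apply/asboolP; exists 0; rewrite ?rpred0 ?raddf0.
move=> /asboolP[p pJ ->] /asboolP[q qJ ->]; apply/asboolP; exists (a *: p + q).
  by rewrite rpredD ?rpredZ.
by rewrite linearP.
Qed.

HB.instance Definition _ (J : submodClosed R^o) :=
  GRing.isSubmodClosed.Build R (quotmod I) (image_sub J) (image_sub_closed J).

Lemma image_subP (J : submodClosed R^o) p :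
  {subset I <= J} -> (quotmod_pi I p \in image_sub J) = (p \in J).
Proof.
move=> IJ; apply/asboolP/idP => [[q qJ /quotmod_pi_eq /IJ]|pJ]; last by exists p.
by move=> h; rewrite -(subrK q p) rpredD.
Qed.

(** A homogeneous component of [p] has only monomials of [p], and membership in [face_ideal K] is a
    condition on monomials. *)
Lemma image_sub_graded (hI : graded_sub (M := poly_graded k n) I) K :
  graded_sub (M := quot_graded hI) (image_sub (face_ideal K)).
Proof.
move=> y /asboolP[p /face_idealP hp ->].
exists (map Posz (iota 0 (msize p))), (fun d => quotmod_pi I (hcomp p d)); split.
- by rewrite map_inj_uniq ?iota_uniq // => ? ? [].
- by move=> d; apply/asboolP; exists (hcomp p d) => //; apply: hcomp_in.
- move=> d; apply/asboolP; exists (hcomp p d) => //; apply/face_idealP => m hm.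
  apply: hp; move: hm; case: d => d /=; last by rewrite msupp0.
  rewrite !mcoeff_msupp; apply: contra => /eqP p0; apply/eqP.
  rewrite pihomogE raddf_sum /= big1 // => m' _; rewrite mcoeffZ mcoeffX.
  by case: eqP => [->|]; rewrite ?p0 ?mul0r ?mulr0.
by rewrite {1}(hcomp_sum p) raddf_sum.
Qed.

Lemma image_sub_quot_rel (J J' : submodClosed R^o) :
  {subset I <= J} -> {subset I <= J'} ->
  quot_rel (fun (p : R^o) (v : subquotient (image_sub J') (image_sub J)) =>
      exists z : submodule_of (image_sub J),
        submodule_val z = quotmod_pi I p /\ v = quotmod_pi _ z)
    (fun p => p \in J) (fun p => p \in J') (@everything _) (fun v => v = 0).
Proof.
move=> IJ IJ'; split.
- move=> a p p' v v' [z [hz ->]] [z' [hz' ->]]; exists (a *: z + z').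
  split; last by rewrite quotmod_pi_is_linear.
  by rewrite (quotmod_pi_is_linear I a p p') -hz -hz'.
- move=> p pJ; have h : quotmod_pi I p \in image_sub J by rewrite image_subP.
  pose z : submodule_of (image_sub J) := exist _ (quotmod_pi I p) h.
  by exists (quotmod_pi _ z) => //; exists z.
- move=> v _; have [z <-] := quotmod_pi_surj v.
  have /asboolP[p pJ E] := valP z; exists p => //; exists z; split=> //.
move=> p v _ _ [z [hz ->]]; rewrite quotmod_pi_eq0 inE hz image_subP //.
Qed.

(** The filtration runs through the facet sizes that occur, in increasing order: each step is then
    proper, and the dimensions, which are these sizes, increase strictly. *)
Lemma sequentially_CM_shelling (hI : graded_sub (M := poly_graded k n) I) D L :
  shelling D L -> (forall A B : {set 'I_n}, A \subset B -> D B -> D A) ->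
  (forall p, (p \in I) = (p \in face_ideal (facets_ge L 0))) ->
  sequentially_CM (quot_graded hI).
Proof.
move=> shL downD hIE.
pose ds := sort leq (undup [seq #|u.2| | u <- L]).
(* The default n + 1 exceeds every facet size, so past the last size no facets remain and the face
   ideal is all of R. *)
pose b i := nth n.+1 ds i.
have dsP d : (d \in ds) = has (fun u => #|u.2| == d) L.
  rewrite mem_sort mem_undup; apply/mapP/hasP => [[p pL ->]|[p pL /eqP <-]]; by exists p.
have ds_sorted : sorted ltn ds.
  rewrite ltn_sorted_uniq_leq sort_uniq undup_uniq.
  exact/sort_sorted/leq_total.
have b_lt i j : (i < j)%N -> (i < size ds)%N -> (b i < b j)%N.
  move=> ij hi; have [hj|hj] := ltnP j (size ds).
    by apply: (sorted_ltn_nth ltn_trans) => //; rewrite ?inE.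
  rewrite {2}/b nth_default //.
  have := mem_nth n.+1 hi; rewrite dsP => /hasP[p _ /eqP cp].
  by rewrite -/(b i) /b -cp ltnS -[X in (_ <= X)%N]card_ord max_card.
have b_mem u : u \in L -> exists2 j, (j < size ds)%N & #|u.2| = b j.
  move=> uL; have : #|u.2| \in ds by rewrite dsP; apply/hasP; exists u.
  by move/(nthP n.+1) => [j hj <-]; exists j.
have b_le i u : u \in L -> (#|u.2| < b i.+1)%N -> (b i <= #|u.2|)%N -> #|u.2| = b i.
  move=> /b_mem[j hj ->] h1 h2; have [ij|ji|->//] := ltngtP i j.
    move: h1; rewrite ltnNge; case/negP; move: ij; rewrite leq_eqVlt => /orP[/eqP ->//|ij].
    by apply/ltnW/b_lt => //; apply: leq_trans hj; apply: ltnW.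
  by move: h2; rewrite leqNgt b_lt.
have lay i : (i < size ds)%N ->
    layered (b i) (facets_ge L (b i.+1)) (facets_ge L (b i)).
  move=> hi; apply: (facets_layered shL downD).
    by move=> p pL /andP[h1 h2]; apply: b_le.
  by rewrite leqnn b_lt.
have ne i : (i < size ds)%N -> facets_ge L (b i.+1) <> facets_ge L (b i).
  move=> hi; have := mem_nth n.+1 hi; rewrite dsP => /hasP[p pL /eqP cp] E.
  have : p.2 \in facets_ge L (b i) by apply/facets_geP; exists p; rewrite ?cp.
  rewrite -E => /facets_geP[q qL [Ep]]; rewrite -Ep cp leqNgt -/(b i).
  by rewrite b_lt.
pose J i : submodClosed R^o := face_ideal (k := k) (facets_ge L (b i)).
pose Fil i : submodClosed (quotmod I) := image_sub (J i).
have IJ i : {subset I <= J i}.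
  move=> p; rewrite hIE; apply: face_ideal_sub; apply/subsetP => F /facets_geP[q qL [-> _]].
  by apply/facets_geP; exists q.
have dims i : (i < size ds)%N ->
   has_krull_dim (subquotient (image_sub (J i)) (image_sub (J i.+1))) (b i) /\
   has_depth (@maximal_ideal k n) (subquotient (image_sub (J i)) (image_sub (J i.+1))) (b i).
  move=> hi; apply: (layered_dim_depth (lay i hi) (ne i hi)).
  exact: (image_sub_quot_rel (IJ i.+1) (IJ i)).
exists (size ds), Fil, b; split.
- split=> y; have [p <-] := quotmod_pi_surj y; rewrite [_ \in Fil _]image_subP //.
    (* Every facet has size at least [b 0], so [J 0] is [I], whose image is zero. *)
    rewrite inE; apply/idP/eqP => [h|/quotmod_pi_eq0]; last exact: IJ.
    apply/quotmod_pi_eq0; rewrite hIE; apply: face_ideal_sub h.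
    apply/subsetP => F /facets_geP[q qL [-> _]]; apply/facets_geP; exists q => //.
    split=> //; have [j hj ->] := b_mem q qL; case: j hj => // j hj.
    by apply/ltnW/b_lt => //; apply: leq_ltn_trans hj.
  apply/face_idealP => m _ F /facets_geP[q _ [_]].
  by rewrite /b nth_default // leqNgt ltnS -[X in (_ <= X)%N]card_ord max_card.
- by move=> i _; apply: image_sub_graded.
- move=> i hi; split.
    move=> y; have [p <-] := quotmod_pi_surj y; rewrite /Fil !image_subP //.
    by apply: face_ideal_sub; apply: layered_sub (lay i hi).
  have [//|p pJ nJ] := layered_proper (k := k) (s := [::]) _ (lay i hi) (ne i hi).
  by exists (quotmod_pi I p); rewrite /Fil image_subP //; apply/negP.
- by move=> i hi; have [h1 h2] := dims i hi; split=> //; exists (b i).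
by move=> i hi; apply: b_lt => //; apply: ltnW.
Qed.

End Filtration.

(** * Directed paths in a rooted tree *)

Section RootedTree.
Variables (n : nat) (e : rel 'I_n) (root : 'I_n).
Hypothesis he : is_tree e.

(** [is_tree] speaks of distinct endpoints; from the root to itself only the empty path is
    simple. *)
Lemma root_path_uniq v p q :
  simple_path e root v p -> simple_path e root v q -> p = q.
Proof.
have nil r : simple_path e root root r -> r = [::].
  case: (lastP r) => // r' a [_]; rewrite last_rcons => ->.
  by rewrite /= mem_rcons inE eqxx.
have [_ _ h] := he; have [<-|ne] := eqVneq root v; first by move=> /nil -> /nil ->.
by have [r [_ u]] := h root v ne; move=> /u <- /u <-.
Qed.

Lemma root_path_exists :
  exists rp : 'I_n -> seq 'I_n, forall v, simple_path e root v (rp v).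
Proof.
have /choice[rp hrp] v : exists p, simple_path e root v p.
  have [_ _ h] := he; have [<-|ne] := eqVneq root v; first by exists [::].
  by have [p [hp _]] := h root v ne; exists p.
by exists rp.
Qed.

Variable rp : 'I_n -> seq 'I_n.
Hypothesis rpP : forall v, simple_path e root v (rp v).

Definition ancestor : rel 'I_n := fun u v => u \in root :: rp v.

(** An initial segment of a simple path is simple, so by uniqueness it is the root path of its
    end. *)
Lemma ancestorP u v : reflect (exists r, rp v = rp u ++ r) (ancestor u v).
Proof.
apply: (iffP idP) => [|[r E]]; last first.
  have [_ lu _] := rpP u; by rewrite /ancestor E -cat_cons mem_cat -{1}lu mem_last.
rewrite /ancestor => uv; have := rpP v; case/splitPl: uv => p1 p2 lp [].
rewrite cat_path -cat_cons cat_uniq => /andP[h1 _] _ /and3P[u1 _ _]; exists p2.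
congr (_ ++ _); exact: (root_path_uniq (v := u)).
Qed.

Lemma ancestor_refl u : ancestor u u.
Proof. by apply/ancestorP; exists [::]; rewrite cats0. Qed.

Lemma ancestor_trans : transitive ancestor.
Proof.
move=> v u w /ancestorP[r E] /ancestorP[r' E']; apply/ancestorP.
by exists (r ++ r'); rewrite E' E catA.
Qed.

Lemma ancestor_size u v : ancestor u v -> u != v -> (size (rp u) < size (rp v))%N.
Proof.
move=> /ancestorP[[|a r] E]; last by rewrite E size_cat /= addnS ltnS leq_addr.
have [_ <- _] := rpP u; have [_ {2}<- _] := rpP v.
by rewrite E cats0 eqxx.
Qed.

(** Two prefixes of the same list are comparable. *)
Lemma ancestor_forest u v w : ancestor u w -> ancestor v w -> ancestor u v || ancestor v u.
Proof.
move=> /ancestorP[r E] /ancestorP[r' E'].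
have prefix_ancestor x y s s' : rp w = rp x ++ s -> rp w = rp y ++ s' ->
    (size (rp x) <= size (rp y))%N -> ancestor x y.
  move=> Ex Ey le; apply/ancestorP; exists (drop (size (rp x)) (rp y)).
  rewrite -[LHS](cat_take_drop (size (rp x))); congr (_ ++ _).
  have := congr1 (take (size (rp x))) Ex; rewrite Ey.
  by rewrite [RHS]take_size_cat // takel_cat.
apply/orP; have [le|/ltnW le] := leqP (size (rp u)) (size (rp v)).
  by left; apply: prefix_ancestor E E' le.
by right; apply: prefix_ancestor E' E le.
Qed.

Lemma directed_edge_root_path u v : directed_edge e root u v -> rp v = rcons (rp u) v.
Proof.
move=> [_ [p [hp lp]]]; rewrite (root_path_uniq (rpP v) hp); congr rcons.
apply: root_path_uniq (rpP u); case: hp; rewrite rcons_path -rcons_cons rcons_uniq.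
by move=> /andP[? _] _ /andP[_ ?].
Qed.

Lemma dpath_root_path t (s : t.+1.-tuple 'I_n) : is_dpath e root s ->
  exists a l, tval s = a :: l /\ path (fun u v => rp v == rcons (rp u) v) a l.
Proof.
move=> hs; case E: (tval s) => [|a l]; first by have := size_tuple s; rewrite E.
exists a, l; split=> //; apply/(pathP a) => i hi; apply/eqP.
have szl : size l = t by have := size_tuple s; rewrite E => -[].
have hi1 : (i < t.+1)%N by rewrite -szl ltnW.
have hi2 : (i.+1 < t.+1)%N by rewrite -szl.
have := hs (Ordinal hi1) (Ordinal hi2) erefl.
by rewrite !(tnth_nth a) E => /directed_edge_root_path.
Qed.

(** * Directed paths as convex chains *)

Section DirectedPath.
Variables (a : 'I_n) (l : seq 'I_n).
Hypothesis hl : path (fun u v => rp v == rcons (rp u) v) a l.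

Lemma root_path_last : rp (last a l) = rp a ++ l.
Proof.
elim: l a hl => [|b l' IH] c /=; first by rewrite cats0.
by case/andP=> /eqP E /IH ->; rewrite E cat_rcons.
Qed.

Lemma dpath_uniq : uniq (a :: l).
Proof.
have [_ _] := rpP (last a l); rewrite root_path_last -cat_cons cat_uniq.
move=> /and3P[_ hn ul]; rewrite /= ul andbT; apply: contra hn => al.
by apply/hasP; exists a => //; apply: ancestor_refl.
Qed.

Lemma dpath_ancestor u : u \in a :: l -> ancestor a u /\ ancestor u (last a l).
Proof.
elim: l a hl u => [|b l' IH] c /=.
  by move=> _ u; rewrite inE => /eqP ->; split; apply: ancestor_refl.
case/andP=> /eqP E /IH {}IH u.
have cb : ancestor c b by apply/ancestorP; exists [:: b]; rewrite E cats1.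
rewrite inE => /predU1P[->|/IH[h1 h2]]; last by split=> //; apply: ancestor_trans h1.
by split; [apply: ancestor_refl | exact: ancestor_trans cb (IH b (mem_head _ _)).2].
Qed.

(** A vertex [w] between two vertices of the path is an ancestor of the last one, whose root path is
    that of [a] followed by [l]. So [w] is in [l] or an ancestor of [a]; in the latter case w = a,
    as [a] is an ancestor of [w]. *)
Lemma dpath_convex_chain : convex_chain ancestor [set: 'I_n] [set i in a :: l].
Proof.
split=> [|u v|u v w]; first exact: subsetT.
  rewrite !inE => /dpath_ancestor[_ h] /dpath_ancestor[_]; exact: ancestor_forest.
rewrite ![_ \in [set _ in _]]inE => /dpath_ancestor[au _] /dpath_ancestor[_ vl] _ uw wv.
have aw := ancestor_trans au uw; have := ancestor_trans wv vl.
rewrite /ancestor root_path_last -cat_cons mem_cat => /orP[wa|wl]; last first.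
  by rewrite inE wl orbT.
have [<-|aw'] := eqVneq a w; first by rewrite inE eqxx.
have wa' : w != a by rewrite eq_sym.
by have := ltn_trans (ancestor_size aw aw') (ancestor_size wa wa'); rewrite ltnn.
Qed.

End DirectedPath.

Definition dpath_sets t : {set {set 'I_n}} :=
  [set E | `[< exists s : t.-tuple 'I_n, is_dpath e root s /\ E = [set i in s] >]].

Lemma path_complex_shelling t :
  exists L, shelling (avoids [set: 'I_n] (dpath_sets t.+1)) L.
Proof.
apply: (@avoids_shelling _ ancestor (fun v => size (rp v))).
- exact: ancestor_refl.
- exact: ancestor_size.
- exact: ancestor_forest.
move=> E; rewrite inE => /asboolP[s [/dpath_root_path[a [l [Es hl]]] ->]].
rewrite (_ : [set i in s] = [set i in a :: l]); first exact: dpath_convex_chain.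
by apply/setP => i; rewrite !inE -[i \in s]/(i \in tval s) Es inE.
Qed.

Variable k : fieldType.

Lemma dpath_monomial t (s : t.+1.-tuple 'I_n) : is_dpath e root s ->
  \prod_(i <- s) 'X_i = 'X_[mesym1 [set i in s]] :> {mpoly k[n]}.
Proof.
case/dpath_root_path=> a [l [Es /dpath_uniq us]]; rewrite -Es in us.
rewrite mprodXE; congr 'X_[_]; apply/mnmP => j.
rewrite mnm_sumE mnmE inE; under eq_bigr do rewrite mnm1E.
rewrite -(count_uniq_mem j us) -sum1_count [RHS]big_mkcond.
by apply: eq_bigr => i _ /=; case: (i == j).
Qed.

(** Facets contain no directed path, so no facet contains the support of a path monomial.
    Conversely, a support lying in no facet is a nonface, hence contains a directed path, whose
    monomial divides. *)
Lemma path_idealE t L p : shelling (avoids [set: 'I_n] (dpath_sets t.+1)) L ->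
  (p \in path_ideal k e root t.+1) = (p \in face_ideal [set F in [seq u.2 | u <- L]]).
Proof.
move=> shL; apply/idP/idP => [/asboolP[s [hs ->]]|/face_idealP hp].
  rewrite big_seq rpred_sum // => g /hs[w hw E]; apply: face_idealMl.
  rewrite E dpath_monomial //; apply/face_idealP => m; rewrite msuppX inE => /eqP ->.
  move=> F; rewrite inE mnm_set_mesym1 => /mapP[u /(sh_facet shL)/avoidsP[_ h] ->].
  by apply: h; rewrite inE; apply/asboolP; exists w.
rewrite [p]mpolyE big_seq; apply: rpred_sum => m /hp hm.
have : ~~ avoids [set: 'I_n] (dpath_sets t.+1) (mnm_set m).
  rewrite (sh_cover shL); apply/hasPn => u uL; rewrite /in_interval negb_and.
  by rewrite hm ?orbT // inE map_f.
rewrite /avoids subsetT /= negb_forall_in => /exists_inP[E].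
rewrite inE => /asboolP[s [hs ->]]; rewrite negbK => sm.
apply/asboolP; exists [:: (p@_m *: 'X_[m - mesym1 [set i in s]], 'X_[mesym1 [set i in s]])].
split=> [g|]; last by rewrite big_seq1 /= -scalerAl -mpolyXD submK // mesym1_le.
by rewrite inE => /eqP ->; exists s => //; rewrite dpath_monomial.
Qed.

End RootedTree.

Theorem theorem1p1 (k : fieldType) (n t : nat) (e : rel 'I_n) (root : 'I_n)
  (ht : (2 <= t)%N) (he : is_tree e) :
  sequentially_CM (quot_graded (@path_ideal_graded k n e root t)).
Proof.
case: t ht => // t _; have [rp hrp] := root_path_exists root he.
have [L shL] := path_complex_shelling he hrp t.
apply: (sequentially_CM_shelling _ shL) => [A B AB /avoidsP[_ hB]|p].
  apply/avoidsP; split=> [|E /hB]; first exact: subsetT.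
  by apply: contra => /subset_trans; apply.
by rewrite (path_idealE he hrp _ shL) /facets_ge filter_predT.
Qed.
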